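(* Let $X$ be a Banach space with a Rosenthal basis $\{e_i\}$, and let $\phi:bb(X)\rightarrow bb(X)$ be a map which is continuous from $bb_E(X)$ to $bb_D(X)$ and such that for every $x=(x_i)\in bb(X)$ the sequence $\phi(x)$ is a subsequence of $x$ which dominates $\{e_i\}$. Then $\{e_i\}$ is equivalent to the unit vector basis of $c_0$ or of $\ell_p$ for some $1\le p<\infty$.
   Context: Scalars are real. A normalized block basis (or normalized block sequence) of a basic sequence $\{e_i\}$ is a sequence of norm-one finite linear combinations of the $e_i$ with successive supports. Two basic sequences $\{x_i\},\{y_i\}$ are equivalent if there is $C\ge 1$ with $C^{-1}\|\sum a_i x_i\|\le\|\sum a_i y_i\|\le C\|\sum a_i x_i\|$ for all finitely supported scalar sequences $(a_i)$. $\{x_i\}$ $K$-dominates $\{y_i\}$ if $K\|\sum a_i x_i\|\ge\|\sum a_i y_i\|$ for all finitely supported $(a_i)$, and dominates $\{y_i\}$ if it $K$-dominates it for some $K>0$. A Rosenthal basis is a normalized Schauder basis $\{e_i\}$ such that every normalized block basis of $\{e_i\}$ has a subsequence equivalent to $\{e_i\}$. For $X$ with basis $\{e_i\}$, $bb(X)$ is the set of (infinite) normalized block bases of $\{e_i\}$; for $A\in bb(X)$, $bb(A)$ is the set of normalized block bases of $A$. $bb_D(X)$ is $bb(X)$ with the topology induced by the product topology on $X^{\mathbb N}$, where $X$ is given the discrete topology. $bb_E(X)$ is $bb(X)$ with the topology whose basic open sets are the sets $[a,A]=\{a^\frown x: x\in bb(A)\}$, where $a=(a_1,\ldots,a_n)$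 is a finite normalized block sequence, $A\in bb(X)$, $a<A$ (the supports of the terms of $a$ precede those of the terms of $A$), and $a^\frown x$ denotes concatenation. *)

(* Defs.v *)
From HB Require Import structures.
From mathcomp Require Import all_boot all_order all_algebra.
From mathcomp Require Import all_classical all_reals all_analysis.

Set Implicit Arguments.
Unset Strict Implicit.
Unset Printing Implicit Defensive.

Import Order.TTheory GRing.Theory Num.Theory numFieldNormedType.Exports.

Local Open Scope classical_set_scope.
Local Open Scope ring_scope.

(** A finitely supported scalar sequence is given as a pair (n, a), standing
    for (a 0, ..., a n.-1, 0, 0, ...). *)
Definition lincomb {R : realType} {V : lmodType R} (x : nat -> V) (n : nat)
    (a : nat -> R) : V := \sum_(i < n) a i *: x i.

(** The norms are explicit arguments so that sequences of a normed space can be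
    compared with the unit vectors of [nat -> R^o] under the norm of c_0 or
    l_p. *)
Definition dominates {R : realType} {V W : lmodType R}
    (NV : V -> R) (x : nat -> V) (NW : W -> R) (y : nat -> W) : Prop :=
  exists2 K : R, 0 < K &
    forall n (a : nat -> R), NW (lincomb y n a) <= K * NV (lincomb x n a).

Definition equivalent {R : realType} {V W : lmodType R}
    (NV : V -> R) (x : nat -> V) (NW : W -> R) (y : nat -> W) : Prop :=
  exists2 C : R, 1 <= C &
    forall n (a : nat -> R),
      C^-1 * NV (lincomb x n a) <= NW (lincomb y n a)
      /\ NW (lincomb y n a) <= C * NV (lincomb x n a).

(** The norms below have the junk values of [sup] and [fine] outside the spaces
    c_0 and l_p; they are only used on finitely supported sequences. *)
Definition c0_norm {R : realType} (a : nat -> R^o) : R :=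
  sup (range (fun k => `|a k|)).

Definition lp_norm {R : realType} (p : R) (a : nat -> R^o) : R :=
  fine ('N[@counting nat R]_(p%:E)[EFin \o a])%E.

Definition unit_vector {R : realType} (i : nat) : nat -> R^o :=
  fun k => (k == i)%:R.

Definition increasing (s : nat -> nat) : Prop :=
  {homo s : i j / (i < j)%N}.

(** [isBaseTopological] requires a pointed index type. *)
HB.instance Definition _ (T : choiceType) := isPointed.Build (seq T) [::].

Section BlockBases.
Context {R : realType} {X : normedModType R}.
Implicit Types (e x y A B : nat -> X) (a b : seq X).

Definition schauder_basis e : Prop :=
  forall v : X, exists! c : nat -> R,
    series (fun i => c i *: e i) @ \oo --> v.

(** [v] is the finite linear combination of [e] with coefficients [c]. *)
Definition expands e (v : X) (c : nat -> R) : Prop :=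
  exists2 n, (forall j, (n <= j)%N -> c j = 0) & v = lincomb e n c.

(** When [e] is linearly independent, the coefficients [c] of a vector are
    unique and its support is [set j | c j != 0]. *)
Definition supp_lt (c d : nat -> R) : Prop :=
  forall j k, c j != 0 -> d k != 0 -> (j < k)%N.

Definition normalized_blocks e (I : set nat) x (c : nat -> nat -> R) : Prop :=
  (forall i, I i -> `|x i| = 1 /\ expands e (x i) (c i))
  /\ (forall i j, I i -> I j -> (i < j)%N -> supp_lt (c i) (c j)).

Definition bb e : set (nat -> X) :=
  [set x | exists c, normalized_blocks e setT x c].

Definition finite_block_seq e a : Prop :=
  exists c, normalized_blocks e [set i | (i < size a)%N] (nth 0 a) c.

Definition precedes e a A : Prop :=
  exists c d : nat -> nat -> R,
    [/\ forall i, (i < size a)%N -> expands e (nth 0 a i) (c i),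
        forall k, expands e (A k) (d k)
      & forall i k, (i < size a)%N -> supp_lt (c i) (d k)].

Definition concat a x : nat -> X :=
  fun i => if (i < size a)%N then nth 0 a i else x (i - size a)%N.

Definition rosenthal_basis e : Prop :=
  [/\ schauder_basis e, forall i, `|e i| = 1 &
      forall x, bb e x -> exists2 s, increasing s &
        equivalent Num.norm (x \o s) Num.norm e].

Definition bbD e : Type := bb e.

HB.instance Definition _ e := Topological.copy (bbD e)
  (initial_topology
    (set_val : bb e -> prod_topology (fun _ : nat => discrete_topology X))).

Definition bbE e : Type := bb e.

HB.instance Definition _ e := Choice.on (bbE e).

(** [aA] ranges over the admissible pairs (a, A), and [basicE e (a, A)] is the
    set [a, A]. *)
Definition admissible e : set (seq X * (nat -> X)) :=
  [set aA | [/\ finite_block_seq e aA.1, bb e aA.2 & precedes e aA.1 aA.2]].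

Definition basicE e (aA : seq X * (nat -> X)) : set (bbE e) :=
  [set x | exists2 y, bb aA.2 y & set_val x = concat aA.1 y].

Lemma expands_trans e x (v : X) (d : nat -> R) (c : nat -> nat -> R) :
  expands x v d -> (forall k, expands e (x k) (c k)) ->
  exists2 f, expands e v f &
    forall j, f j != 0 -> exists2 k, d k != 0 & c k j != 0.
Proof.
move=> [n d0 ->] xc.
have /choice[N NP] : forall k, exists n, (forall j, (n <= j)%N -> c k j = 0) /\
    x k = lincomb e n (c k) by move=> k; have [m ? ?] := xc k; exists m.
pose M := \max_(k < n) N k.
exists (fun j => \sum_(k < n) d k * c k j); last first.
  move=> j fj; apply: contrapT => nk; case/eqP: fj.
  rewrite big1// => k _; apply/eqP; rewrite mulf_eq0.
  by apply/negPn/negP; rewrite negb_or => /andP[? ?]; apply: nk; exists k.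
exists M => [j Mj|].
  rewrite big1// => k _; rewrite (NP k).1 ?mulr0//.
  by apply: leq_trans Mj; apply: (leq_bigmax k).
rewrite /lincomb; under [RHS]eq_bigr do rewrite scaler_suml.
rewrite exchange_big /=; apply: eq_bigr => k _.
under eq_bigr do rewrite -scalerA.
rewrite -scaler_sumr; congr (_ *: _); rewrite (NP k).2 /lincomb.
have NM : (N k <= M)%N by apply: (leq_bigmax k).
rewrite (big_ord_widen _ (fun j => c k j *: e j) NM).
rewrite [RHS](bigID (fun j : 'I_M => j < N k)%N) /=.
rewrite [X in _ = _ + X]big1 ?addr0// => j; rewrite -leqNgt => Nj.
by rewrite (NP k).1// scale0r.
Qed.

Lemma bb_graft e x y p : bb e x -> bb (fun k => x (k + p)%N) y ->
  bb e (fun i => if (i < p)%N then x i else y (i - p)%N).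
Proof.
move=> [c [xc clt]] [d [yd dlt]].
have /choice[f fP] : forall i, exists f, expands e (y i) f /\
    forall j, f j != 0 -> exists2 k, d i k != 0 & c (k + p)%N j != 0.
  move=> i.
  have [f fy fk] := expands_trans (yd i I).2 (fun k => (xc (k + p)%N I).2).
  by exists f.
exists (fun i => if (i < p)%N then c i else f (i - p)%N); split=> [i _|i j _ _ ij].
  by case: ifPn => ip; [exact: xc|split; [exact: (yd _ I).1|exact: (fP _).1]].
case: ifPn => ip; case: ifPn => jp.
- exact: clt.
- move=> k l ck /(fP _).2[m _ cm]; apply: (clt i (m + p)%N) ck cm => //.
  by rewrite (leq_trans ip)// leq_addl.
- by rewrite (ltn_trans ij jp) in ip.
- move=> k l /(fP _).2[m dm cm] /(fP _).2[m' dm' cm'].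
  apply: (clt (m + p)%N (m' + p)%N) cm cm' => //; rewrite ltn_add2r.
  apply: (dlt (i - p)%N (j - p)%N) dm dm' => //.
  by rewrite -!leqNgt in ip jp; rewrite ltn_sub2r// (leq_ltn_trans ip ij).
Qed.

Lemma bb_trans e x y : bb e x -> bb x y -> bb e y.
Proof.
move=> ex xy; have -> : y = (fun i => if (i < 0)%N then x i else y (i - 0)%N).
  by apply/funext => i; rewrite subn0.
apply: (@bb_graft e x y 0) => //; suff -> : (fun k => x (k + 0)%N) = x by [].
by apply/funext => i; rewrite addn0.
Qed.

Lemma bb_refl e x : bb e x -> bb x x.
Proof.
move=> [c [xc _]]; exists (fun i k => (k == i)%:R); split=> [i _|i j _ _ ij k l].
  split; first exact: (xc i I).1.
  exists i.+1 => [j ij|]; first by rewrite gtn_eqF.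
  rewrite /lincomb big_ord_recr/= eqxx scale1r big1 ?add0r// => k _.
  by rewrite ltn_eqF// scale0r.
by rewrite !pnatr_eq0 !eqb0 !negbK => /eqP-> /eqP->.
Qed.

Lemma basicE_sub e a b A (x : bbE e) y :
  (size a <= size b)%N -> basicE (a, A) x -> bb e (set_val x) ->
  set_val x = concat b y -> basicE (b, y) `<=` basicE (e := e) (a, A).
Proof.
move=> ab [u /= Au xu] ex xy z [w /= yw zw].
exists (fun i => set_val z (i + size a)%N); last first.
  rewrite /concat; apply/funext => i; case: ifPn => ia; last first.
    by rewrite subnK// leqNgt.
  rewrite zw /concat (leq_trans ia ab).
  have /(congr1 (fun f => f i)) := xu; rewrite xy /concat ia.
  by rewrite (leq_trans ia ab).
pose p := (size b - size a)%N.
have ux k : u k = set_val x (k + size a)%N.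
  by rewrite xu /concat ltnNge leq_addl /= addnK.
rewrite /=.
have -> : (fun i => set_val z (i + size a)%N) =
    (fun i => if (i < p)%N then u i else w (i - p)%N).
  apply/funext => i; rewrite ux zw xy /concat /p.
  have -> : (i < size b - size a)%N = (i + size a < size b)%N.
    by rewrite ltn_subRL addnC.
  case: ifPn => //; rewrite -leqNgt => bi; congr (w _).
  by rewrite subnBA.
apply: bb_graft => //; suff -> : (fun k => u (k + p)%N) = y by [].
apply/funext => k; rewrite ux xy /concat -addnA /p subnK//.
by rewrite ltnNge leq_addl /= addnK.
Qed.

Let basicE_cover e : \bigcup_(aA in admissible e) basicE aA = [set: bbE e].
Proof.
apply/seteqP; split=> // x _; have ex : bb e (set_val x) by exact: set_valP.
exists ([::], set_val x).
  split=> //=; first by exists (fun _ _ => 0); split.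
  have [c [xc _]] := ex; exists (fun _ _ => 0), c; split=> // k.
  exact: (xc k I).2.
exists (set_val x); first exact: bb_refl ex.
by apply/funext => i; rewrite /concat /= subn0.
Qed.

Let basicE_join e (i j : seq X * (nat -> X)) (t : bbE e) :
  admissible e i -> admissible e j -> basicE i t -> basicE j t ->
  exists k, [/\ admissible e k, basicE k t
    & basicE (e := e) k `<=` basicE i `&` basicE j].
Proof.
wlog ij : i j / (size i.1 <= size j.1)%N => [wl|].
  have [|/ltnW] := leqP (size i.1) (size j.1); first exact: wl.
  move=> ji Di Dj bi bj; have [k [Dk bk kij]] := wl _ _ ji Dj Di bj bi.
  by exists k; split=> //; rewrite setIC.
case: i j ij => a A [b B] /= ab _ [/= bfin eB [c [d [bc Bd cd]]]] At Bt.
have [y /= By ty] := Bt.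
have et : bb e (set_val t) by exact: set_valP.
exists (b, y); split.
- split=> //=; first exact: bb_trans By.
  have [g [yg _]] := By.
  have /choice[f fP] : forall k, exists f, expands e (y k) f /\
      forall j, f j != 0 -> exists2 l, g k l != 0 & d l j != 0.
    by move=> k; have [f ? ?] := expands_trans (yg k I).2 Bd; exists f.
  exists c, f; split=> // [k|i k ib l m cl /(fP k).2[n _]]; first exact: (fP k).1.
  exact: cd cl.
- by exists y => //; apply: bb_refl By.
- rewrite subsetI; split; first exact: basicE_sub At et ty.
  exact: basicE_sub Bt et ty.
Qed.

HB.instance Definition _ e :=
  isBaseTopological.Build (bbE e) (@basicE_cover e) (@basicE_join e).

End BlockBases.

(* Main.v *)
Require Import Defs.
From HB Require Import structures.
From mathcomp Require Import all_boot all_order all_algebra.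
From mathcomp Require Import all_classical all_reals all_analysis.
From mathcomp Require Import ring lra zify.
Import Order.TTheory GRing.Theory Num.Theory numFieldNormedType.Exports.
Local Open Scope classical_set_scope.
Local Open Scope ring_scope.

(** The Rosenthal property alone gives uniform subsymmetry, by Nash-Williams'
    theorem applied to the closed sets of those [s] for which [e \o s] is
    [D]-equivalent to [e], and then unconditionality, because the blocks
    [e (2i) - e (2i+1)] of a subsymmetric sequence are unconditional.

    Identify finitely supported scalar sequences with polynomials, and let
    [b (x) c] be the sequence which repeats [c] along consecutive intervals with
    weights [b]. Continuity of [phi] and a fusion argument make the domination
    of [e] by [phi x] uniform on a basic open set, whence
    [|b| |c| <= D |b (x) c|]. The Rosenthal property gives the reverse
    inequality: if it failed for [c_k] with constant [4^k], then no subsequence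
    of the block sequence made of disjoint copies of [sum_k 2^-k c_k] could be
    dominated by [e].

    Hence [|e_0 + ... + e_(n-1)|] is multiplicative up to a constant, so it is
    equivalent to [n^a] for some [a] in [0, 1]. If [a = 0] this is [c_0].
    Otherwise let [p = 1/a]: the [k]-th tensor power of a sequence with values
    in [{0} \cup {2^-t}] has only O(k) level sets, so its norm is its [l_p] norm
    up to a factor O(k), and taking [k]-th roots removes that factor. *)

(** * Nash-Williams' theorem *)

Definition unbounded (M : set nat) : Prop := forall n, exists2 m, M m & (n < m)%N.

Definition above (b : seq nat) : set nat := [set m | forall x, x \in b -> (x < m)%N].

(** Finite sets of naturals are sorted lists and infinite ones increasing functions; for sorted [b]
    this is the basic Ellentuck set [b, M]. *)
Definition extensions (b : seq nat) (M : set nat) : set (nat -> nat) :=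
  [set s | [/\ increasing s, forall i, (i < size b)%N -> s i = nth 0%N b i
             & forall i, (size b <= i)%N -> M (s i)]].

Definition increasing_in (b : seq nat) (M : set nat) : Prop :=
  sorted ltn b /\ forall x, x \in b -> M x.

Lemma increasingS (s : nat -> nat) : (forall i, (s i < s i.+1)%N) -> increasing s.
Proof. by move=> ss i j; apply: (homo_ltn ltn_trans). Qed.

Lemma increasing_comp (s t : nat -> nat) :
  increasing s -> increasing t -> increasing (s \o t).
Proof. by move=> si ti i j ij; apply/si/ti. Qed.

Lemma increasing_ge (s : nat -> nat) : increasing s -> forall i, (i <= s i)%N.
Proof. by move=> si; elim=> // i /leq_ltn_trans; apply; apply: si. Qed.

Lemma unbounded_above (b : seq nat) (M : set nat) :
  unbounded M -> unbounded (M `&` above b).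
Proof.
move=> Mu n; have [m Mm nm] := Mu (maxn n (\max_(x <- b) x)).
exists m; last by apply: leq_ltn_trans nm; rewrite leq_maxl.
split=> // x xb; apply: leq_ltn_trans nm; rewrite leq_max orbC.
by rewrite (leq_bigmax_seq (F := id))//.
Qed.

Lemma unbounded_enum (M : set nat) : unbounded M ->
  exists2 s, increasing s & forall i, M (s i).
Proof.
move=> Mu.
have /choice[f fP] : forall n, exists m, M m /\ (n < m)%N.
  by move=> n; have [m ? ?] := Mu n; exists m.
exists (fun i => iter i.+1 f 0%N).
  by apply: increasingS => i /=; apply: (fP _).2.
by move=> i /=; apply: (fP _).1.
Qed.

Lemma increasing_unbounded (s : nat -> nat) : increasing s -> unbounded (range s).
Proof.
move=> si n; exists (s n.+1); first by exists n.+1.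
exact: increasing_ge.
Qed.

Lemma extensions_above b M s i :
  extensions b M s -> (size b <= i)%N -> above b (s i).
Proof.
move=> [si sb _] bi x xb; rewrite -(nth_index 0%N xb) -sb ?index_mem//.
by apply: si; apply: leq_trans bi; rewrite index_mem.
Qed.

Lemma extensions_sub b M M' :
  M' `&` above b `<=` M -> extensions b M' `<=` extensions b M.
Proof.
move=> M'M s sM'; have [si sb sM] := sM'; split=> // i bi.
by apply: M'M; split; [exact: sM|exact: extensions_above sM' bi].
Qed.

(** The first hypothesis on [P] says that [P b M] survives shrinking [M] and depends only on the
    part of [M] above [b]. So one picks points [n k] one at a time from shrinking reservoirs,
    treating after each choice the finitely many lists that end in the new point; all later points
    lie in the reservoir obtained for them. *)
Lemma fusion (P : seq nat -> set nat -> Prop) (M0 : set nat) :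
  unbounded M0 ->
  (forall b M M', M' `&` above b `<=` M -> P b M -> P b M') ->
  (forall b M, increasing_in b M0 -> M `<=` M0 -> unbounded M ->
    exists M', [/\ M' `<=` M, unbounded M' & P b M']) ->
  exists M', [/\ M' `<=` M0, unbounded M' &
    forall b, increasing_in b M' -> P b M'].
Proof.
move=> M0u Psub Pex.
have Pseq (l : seq (seq nat)) M : (forall b, b \in l -> increasing_in b M0) ->
    M `<=` M0 -> unbounded M ->
    exists M', [/\ M' `<=` M, unbounded M' & forall b, b \in l -> P b M'].
  elim: l M => [|b l IH] M lM0 MM0 Mu; first by exists M; split.
  have [|M1 [M1M M1u PM1]] := Pex b M _ MM0 Mu; first by apply: lM0; rewrite mem_head.
  have [| |//|M2 [M2M1 M2u PM2]] := IH M1.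
  - by move=> c cl; apply: lM0; rewrite inE cl orbT.
  - exact: subset_trans MM0.
  exists M2; split=> [|//|c]; first exact: subset_trans M1M.
  rewrite inE => /predU1P[->|/PM2//].
  by apply: Psub PM1 => m [/M2M1].
(* A state is a reservoir together with the list of all finite sets of points chosen so far; each of
   these sets lies below the reservoir. *)
pose good (st : set nat * seq (seq nat)) :=
  [/\ unbounded st.1, st.1 `<=` M0 & forall b, b \in st.2 ->
     increasing_in b M0 /\ st.1 `<=` above b].
pose next (st st' : set nat * seq (seq nat)) (n : nat) :=
  [/\ good st', st'.1 `<=` st.1 `&` above [:: n], st.1 n,
      st'.2 = st.2 ++ [seq rcons c n | c <- st.2] &
      forall b, b \in [seq rcons c n | c <- st.2] -> P b st'.1].
have nextP st : good st -> exists st'n, next st st'n.1 st'n.2.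
  case: st => M L [/= Mu MM0 LP]; have [n Mn _] := Mu 0%N.
  have newM0 b : b \in [seq rcons c n | c <- L] -> increasing_in b M0.
    case/mapP=> c cL ->; have [[cs cM0] Mc] := LP c cL; split.
      case: c cs cM0 Mc cL => //= x c xc _ Mc _; rewrite rcons_path xc /=.
      by apply: (Mc n Mn); rewrite mem_last.
    by move=> x; rewrite mem_rcons inE => /predU1P[->|/cM0//]; apply: MM0.
  have [|M' [M'M M'u M'P]] := Pseq _ (M `&` above [:: n]) newM0 _
    (unbounded_above [:: n] M Mu); first by move=> m [/MM0].
  exists ((M', L ++ [seq rcons c n | c <- L]), n); split=> //; split=> //=.
    by move=> m /M'M[/MM0].
  move=> b; rewrite mem_cat => /orP[bL|bL].
    have [bM0 Mb] := LP b bL; split=> // m /M'M[Mm _]; exact: Mb.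
  split; first exact: newM0.
  case/mapP: bL => c cL -> m /M'M[Mm mn] x.
  rewrite mem_rcons inE => /predU1P[->|]; first by apply: mn; rewrite mem_head.
  exact: (LP c cL).2.
have nextP' (st : set nat * seq (seq nat)) : exists st'n, good st -> next st st'n.1 st'n.2.
  by have [/nextP[y ?]|] := pselect (good st); [exists y|exists (st, 0%N)].
have [f fP] := choice nextP'.
have [||M1 [M1M0 M1u PM1]] := Pseq [:: [::]] M0 _ _ M0u => //.
  by move=> b; rewrite inE => /eqP->.
pose st := fix st k := if k is k'.+1 then (f (st k')).1 else (M1, [:: [::]]).
have st_good k : good (st k).
  elim: k => [|k /fP[]//]; split=> //= b; rewrite inE => /eqP->.
  by split.
have st_next k : next (st k) (st k.+1) (f (st k)).2 by exact: fP.
pose n k := (f (st k)).2.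
have stM j k : (j <= k)%N -> (st k).1 `<=` (st j).1.
  move=> /subnK <-; elim: (k - j)%N => [//|i IH] m.
  by rewrite addSn; have [_ sub _ _ _] := st_next (i + j)%N => /sub[/IH].
have stn k : (st k).1 (n k) by have [] := st_next k.
have ninc : increasing n.
  apply: increasingS => k; have [_ sub _ _ _] := st_next k.
  by have [_] := sub _ (stn k.+1); apply; rewrite mem_head.
have nn j k : (n j < n k)%N -> (j < k)%N.
  by apply: contraTT; rewrite -!leqNgt; apply: (homo_leq leqnn leq_trans) => i; apply/ltnW/ninc.
(* Bookkeeping: the lists stored at stage [k] include every increasing list with entries among the
   first [k] chosen points. *)
have Lmem k b : sorted ltn b -> (forall x, x \in b -> exists2 j, (j < k)%N & n j = x) ->
    b \in (st k).2.
  elim: k b => [|k IH] b bs bk.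
    by case: b bs bk => // x b _ /(_ x (mem_head _ _))[].
  have [_ _ _ -> _] := st_next k; rewrite mem_cat.
  case/lastP: b bs bk => [|c x] bs bk; first by rewrite IH.
  move: bs; rewrite (sorted_pairwise ltn_trans) pairwise_rcons => /andP[/allP cx].
  rewrite -(sorted_pairwise ltn_trans) => cs.
  have cj i y : n i = x -> y \in c -> exists2 j, (j < i)%N & n j = y.
    move=> ix yc; have [j _ jy] := bk y (ltac:(by rewrite mem_rcons inE yc orbT)).
    by exists j => //; apply: nn; rewrite jy ix; exact: cx.
  have [j jk jx] := bk x (ltac:(by rewrite mem_rcons mem_head)).
  have [jk'|kj] := ltnP j k.
    rewrite IH// => [|y].
      rewrite (sorted_pairwise ltn_trans) pairwise_rcons.
      by rewrite -(sorted_pairwise ltn_trans) cs andbT; apply/allP.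
    rewrite mem_rcons inE => /predU1P[->|/(cj j y jx)[i ij <-]]; first by exists j.
    by exists i => //; apply: ltn_trans jk'.
  have jek : j = k by apply/eqP; rewrite eqn_leq kj -ltnS jk.
  apply/orP; right; rewrite -jx jek; apply: map_f; apply: IH => // y.
  by apply: cj; rewrite -jek.
exists (range n); split=> [_ [k _ <-]||b].
- have [_ sub _] := st_good k; exact/sub/stn.
- exact: increasing_unbounded.
case/lastP: b => [|c x] [bs bn].
  apply: (Psub _ M1); last by apply: PM1; rewrite inE.
  by move=> _ [[k _ <-] _]; apply: (stM 0%N k) => //; exact: stn.
have [k _ kx] := bn x (ltac:(by rewrite mem_rcons mem_head)).
have [_ _ _ _ Pk] := st_next k.
(* The last entry of the list is [n k], so the chosen points above it are the [n j] with [k < j],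
   all in the reservoir of stage [k.+1]. *)
apply: (Psub _ (st k.+1).1); last first.
  apply: Pk; rewrite -/(n k) kx; apply: map_f.
  move: bs; rewrite (sorted_pairwise ltn_trans) pairwise_rcons => /andP[/allP cx].
  rewrite -(sorted_pairwise ltn_trans) => cs; apply: Lmem => // y yc.
  have [j _ jy] := bn y (ltac:(by rewrite mem_rcons inE yc orbT)).
  by exists j => //; apply: nn; rewrite jy kx; exact: cx.
move=> _ [[j _ <-] /(_ x)]; rewrite mem_rcons mem_head => /(_ isT) xj.
by apply: (stM k.+1 j _ _ (stn j)); apply: nn; rewrite kx.
Qed.

(* Nash-Williams, by combinatorial forcing: a finite set [b] is accepted by [M] when
   every extension of [b] in [M] lies in [O], and rejected when no infinite subset
   of [M] accepts it. *)
Lemma ramsey_open (O : set (nat -> nat)) (M0 : set nat) :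
  (forall s, O s -> exists n, forall s', (forall i, (i < n)%N -> s' i = s i) -> O s') ->
  unbounded M0 ->
  exists M, [/\ M `<=` M0, unbounded M &
    extensions [::] M `<=` O \/ extensions [::] M `<=` ~` O].
Proof.
move=> Oopen M0u.
pose accepts b M := extensions b M `<=` O.
pose rejects b M := forall M', M' `<=` M -> unbounded M' -> ~ accepts b M'.
have acc_sub b M M' : M' `&` above b `<=` M -> accepts b M -> accepts b M'.
  by move=> /extensions_sub M'M; apply: subset_trans.
have rej_sub b M M' : M' `&` above b `<=` M -> rejects b M -> rejects b M'.
  move=> M'M rej N NM' Nu accN; apply: (rej (N `&` above b)).
  - by apply: subset_trans M'M => m [/NM'].
  - exact: unbounded_above.
  - by apply: acc_sub accN => m [[]].
have [||M1 [M1M0 M1u dec]] :=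
    @fusion (fun b M => accepts b M \/ rejects b M) M0 M0u.
- by move=> b M M' M'M [/(acc_sub _ _ _ M'M)|/(rej_sub _ _ _ M'M)]; [left|right].
- move=> b M _ _ Mu.
  have [[M' [M'M M'u accM']]|nex] :=
      pselect (exists M', [/\ M' `<=` M, unbounded M' & accepts b M']).
    by exists M'; split=> //; left.
  by exists M; split=> //; right=> M' M'M M'u acc; apply: nex; exists M'.
have nil1 M : increasing_in [::] M by split.
have [acc|rej0] := dec [::] (nil1 M1).
  by exists M1; split=> //; left.
(* The second fusion makes rejection hereditary: one-point extensions of a rejected set are
   rejected, so rejection passes by induction from the empty set to all finite subsets of [M2]. *)
have [||M2 [M2M1 M2u rejS]] :=
    @fusion (fun b M => rejects b M1 -> forall n, M n -> above b n ->
                        rejects (rcons b n) M1) M1 M1u.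
- by move=> b M M' M'M PM rb n M'n bn; apply: PM => //; apply: M'M.
- move=> b M bM1 MM1 Mu.
  have [rb|nrb] := pselect (rejects b M1); last by exists M; split.
  (* If infinitely many one-point extensions of [b] were accepted, their points would form an
     infinite set accepting [b]. So these points are bounded and can be discarded. *)
  pose Q := [set n | [/\ M n, above b n & accepts (rcons b n) M1]].
  have [Qu|Qb] := pselect (unbounded Q).
    case: (rb Q) => // [n [/MM1]//|s sQ]; have [si sb sM] := sQ.
    have [Ms ba acc] := sM (size b) (leqnn _).
    apply: acc; split=> // i; rewrite size_rcons.
      rewrite ltnS leq_eqVlt nth_rcons => /predU1P[->|ib]; first by rewrite ltnn eqxx.
      by rewrite ib sb.
    by move=> bi; have [/MM1] := sM i (ltnW bi).
  have [N NQ] : exists N, forall m, Q m -> (m <= N)%N.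
    apply: contrapT => nN; apply: Qb => n; apply: contrapT => nm; apply: nN.
    by exists n => m Qm; rewrite leqNgt; apply/negP => nltm; apply: nm; exists m.
  exists (M `&` above [:: N]); split=> //; [exact: unbounded_above|].
  move=> _ n [Mn Nn] bn.
  have [acc|//] : accepts (rcons b n) M1 \/ rejects (rcons b n) M1.
    apply: dec; have [bs bM] := bM1; split.
      rewrite (sorted_pairwise ltn_trans) pairwise_rcons.
      by rewrite -(sorted_pairwise ltn_trans) bs andbT; apply/allP.
    by move=> x; rewrite mem_rcons inE => /predU1P[->|/bM//]; exact: MM1.
  have /NQ : Q n by split.
  by rewrite leqNgt Nn// mem_head.
have rejb b : increasing_in b M2 -> rejects b M1.
  elim/last_ind: b => [//|b n IH] [].
  rewrite (sorted_pairwise ltn_trans) pairwise_rcons -(sorted_pairwise ltn_trans).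
  move=> /andP[/allP bn bs] bM.
  have bM2 : increasing_in b M2.
    by split=> // x xb; apply: bM; rewrite mem_rcons inE xb orbT.
  apply: (rejS b) => //; first exact: IH.
  by apply: bM; rewrite mem_rcons mem_head.
exists M2; split=> //; first exact: subset_trans M1M0.
(* Membership of [s] in the open set [O] is decided by an initial segment of [s], which would then
   be accepted by [M1]. *)
right=> s [si _ sM] Os; have [n nO] := Oopen s Os.
apply: (rejb (mkseq s n) _ M1) => //.
- split; first by apply: (homo_sorted si); exact: iota_ltn_sorted.
  by move=> x /mapP[i _ ->]; apply: sM.
- move=> t [_ tb _]; apply: nO => i ilt; rewrite tb ?size_mkseq//.
  by rewrite nth_mkseq.
Qed.

(* Otherwise, by Ramsey, each [E D] can be avoided by all extensions of a given finite
   set in a smaller infinite set, and a fusion avoids all the [E D] at once. *)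
Lemma ramsey_closed_cover (E : nat -> set (nat -> nat)) :
  (forall D s, ~ E D s -> exists n, forall s', (forall i, (i < n)%N -> s' i = s i) -> ~ E D s') ->
  (forall M, unbounded M -> exists s, [/\ increasing s, forall i, M (s i) &
     exists D0, forall D, (D0 <= D)%N -> E D s]) ->
  exists D b M, [/\ sorted ltn b, unbounded M & extensions b M `<=` E D].
Proof.
move=> Ecl Ecov; apply: contrapT => nex.
(* The index of the set to be avoided is the length of [b]. A sequence lying in [E D] for all large
   [D] then contradicts this at its own initial segment of length [D]. *)
have [|||M [_ Mu EM]] := @fusion
    (fun b M => sorted ltn b -> extensions b M `<=` ~` E (size b)) setT.
- by move=> n; exists n.+1.
- by move=> b M M' /extensions_sub M'M PM bs s /M'M /(PM bs).
- move=> b M _ _ Mu.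
  pose cat s := fun i => if (i < size b)%N then nth 0%N b i else s (i - size b)%N.
  have [||M' [M'M M'u hom]] := @ramsey_open [set s | ~ E (size b) (cat s)] M.
  - move=> s /= /Ecl[n nE]; exists n => s' ss'; apply: nE => i ilt.
    rewrite /cat; case: ifP => // _; apply: ss'.
    by apply: leq_ltn_trans ilt; rewrite leq_subr.
  - by [].
  have catE s : extensions b M' s -> exists2 s', extensions [::] M' s' & s = cat s'.
    move=> [si sb sM]; exists (fun i => s (i + size b)%N).
      split=> // [i j ij|i _]; first by apply: si; rewrite ltn_add2r.
      by apply: sM; rewrite leq_addl.
    apply/funext => i; rewrite /cat; case: ifPn => [/sb//|].
    by rewrite -leqNgt => bi; rewrite subnK.
  exists M'; split=> // bs s /catE[s' s'M ->].
  case: hom => hom; first exact: hom.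
  case: nex; exists (size b), b, M'; split=> // t /catE[t' t'M ->].
  by have /contrapT := hom _ t'M.
have [s [si sM [D ED]]] := Ecov M Mu.
have szD : size (mkseq s D) = D by rewrite size_mkseq.
have bs : sorted ltn (mkseq s D) by apply: (homo_sorted si); exact: iota_ltn_sorted.
apply: (EM (mkseq s D) _ bs s); last by rewrite szD; exact: ED.
- by split=> // x /mapP[i _ ->].
- split=> // i; rewrite szD => iD; by rewrite nth_mkseq.
Qed.

(** * Linear combinations indexed by polynomials *)

(** With a polynomial in place of a pair (n, a), [lin x] is a linear map sending ['X^i] to [x i],
    and a shift of the coefficients is multiplication by a power of ['X]. *)
Definition lin {R : realType} {V : lmodType R} (x : nat -> V) (p : {poly R}) : V :=
  \sum_(i < size p) p`_i *: x i.

Definition spread {R : realType} (s : nat -> nat) : {poly R} -> {poly R} :=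
  lin (fun i => 'X^(s i)).

Definition keep {R : realType} (P : pred nat) : {poly R} -> {poly R} :=
  lin (fun i => if P i then 'X^i else 0).

Section Lin.
Context {R : realType}.
Implicit Types (V : lmodType R) (p q : {poly R}).

Lemma lin_widen {V} n (x : nat -> V) p :
  (size p <= n)%N -> lin x p = \sum_(i < n) p`_i *: x i.
Proof.
move=> pn; rewrite /lin (big_ord_widen n (fun i => p`_i *: x i) pn).
rewrite [RHS](bigID (fun i : 'I_n => i < size p)%N) /= [X in _ = _ + X]big1 ?addr0//.
by move=> i; rewrite -leqNgt => pi; rewrite nth_default// scale0r.
Qed.

Lemma lin_is_linear {V} (x : nat -> V) : linear (lin x).
Proof.
move=> c p q; pose n := maxn (size p) (size q).
have pn : (size p <= n)%N by rewrite leq_maxl.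
have qn : (size q <= n)%N by rewrite leq_maxr.
rewrite (@lin_widen _ n); last first.
  by rewrite (leq_trans (size_polyD _ _))// geq_max qn (leq_trans (size_scale_leq _ _)).
rewrite (lin_widen n x p pn) (lin_widen n x q qn).
rewrite scaler_sumr -big_split /=; apply: eq_bigr => i _.
by rewrite coefD coefZ scalerDl scalerA.
Qed.

HB.instance Definition _ V (x : nat -> V) :=
  GRing.isLinear.Build R {poly R} V _ (lin x) (lin_is_linear x).

HB.instance Definition _ (s : nat -> nat) :=
  GRing.isLinear.Build R {poly R} {poly R} _ (spread s) (lin_is_linear _).

HB.instance Definition _ (P : pred nat) :=
  GRing.isLinear.Build R {poly R} {poly R} _ (keep P) (lin_is_linear _).

Lemma linX {V} (x : nat -> V) i : lin x 'X^i = x i.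
Proof.
rewrite /lin size_polyXn big_ord_recr /= coefXn eqxx scale1r big1 ?add0r//.
by move=> j _; rewrite coefXn ltn_eqF ?scale0r.
Qed.

Lemma lin_lin {V} (x : nat -> V) (g : nat -> {poly R}) p :
  lin x (lin g p) = lin (fun i => lin x (g i)) p.
Proof. by rewrite {2}/lin linear_sum; apply: eq_bigr => i _; rewrite linearZ. Qed.

Lemma linZ {V} (x : nat -> V) (c : nat -> R) p :
  lin (fun i => c i *: x i) p = lin x (\poly_(i < size p) (p`_i * c i)).
Proof.
rewrite [RHS](lin_widen (size p)) ?size_poly//.
by apply: eq_bigr => i _; rewrite coef_poly ltn_ord scalerA.
Qed.

Lemma linB {V} (x y : nat -> V) p :
  lin (fun i => x i - y i) p = lin x p - lin y p.
Proof. by rewrite /lin -sumrB; apply: eq_bigr => i _; rewrite scalerBr. Qed.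

Lemma lin_sum {V} (I : finType) (x : I -> nat -> V) p :
  lin (fun i => \sum_j x j i) p = \sum_j lin (x j) p.
Proof.
rewrite /lin exchange_big /=; apply: eq_bigr => i _.
by rewrite scaler_sumr.
Qed.

Lemma eq_lin {V} (x y : nat -> V) p :
  (forall i, (i < size p)%N -> x i = y i) -> lin x p = lin y p.
Proof. by move=> xy; apply: eq_bigr => i _; rewrite xy. Qed.

Lemma lin_poly {V} (x : nat -> V) n (a : nat -> R) :
  lin x (\poly_(i < n) a i) = lincomb x n a.
Proof.
rewrite (lin_widen n) ?size_poly//.
by apply: eq_bigr => i _; rewrite coef_poly ltn_ord.
Qed.

Lemma lin_subseq {V} (x : nat -> V) s p : lin (x \o s) p = lin x (spread s p).
Proof. by rewrite lin_lin; apply: eq_lin => i _; rewrite linX. Qed.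

Lemma coef_lin (g : nat -> {poly R}) p i :
  (lin g p)`_i = \sum_(j < size p) p`_j * (g j)`_i.
Proof. by rewrite coef_sum; apply: eq_bigr => j _; rewrite coefZ. Qed.

Lemma coef_keep P p i : (keep P p)`_i = if P i then p`_i else 0.
Proof.
rewrite coef_lin; have [ip|ip] := ltnP i (size p); last first.
  rewrite [p`_i]nth_default// if_same big1// => j _.
  case: ifP => _; rewrite ?coef0 ?mulr0// coefXn gtn_eqF ?mulr0//.
  exact: leq_trans ip.
rewrite (bigD1 (Ordinal ip)) //= big1 ?addr0 => [|j ji].
  by case: ifP => _; rewrite ?coef0 ?mulr0// coefXn eqxx mulr1.
case: ifP => _; rewrite ?coef0 ?mulr0// coefXn.
by rewrite eq_sym (_ : (j == i :> nat) = false) ?mulr0//; apply/negbTE.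
Qed.

Lemma lin_keep {V} (x : nat -> V) P p :
  lin x (keep P p) = lin (fun i => if P i then x i else 0) p.
Proof.
rewrite lin_lin; apply: eq_lin => i _.
by case: ifP => _; rewrite ?linX ?linear0.
Qed.

Lemma lin_Xn p : lin (fun i => 'X^i) p = p.
Proof. by rewrite /lin -[RHS]coefK poly_def. Qed.

Lemma lin_mulr (g : nat -> {poly R}) p q : lin (fun i => g i * q) p = lin g p * q.
Proof. by rewrite /lin mulr_suml; apply: eq_bigr => i _; rewrite scalerAl. Qed.

Lemma spreadMXn n p : spread (fun i => i + n)%N p = p * 'X^n.
Proof.
rewrite -[in RHS](lin_Xn p) -lin_mulr; apply: eq_lin => i _.
by rewrite exprD.
Qed.

End Lin.

Section Domination.
Context {R : realType}.
Implicit Types (V W : normedModType R) (C : R).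

Definition dom {V W} C (x : nat -> V) (y : nat -> W) : Prop :=
  forall p : {poly R}, `|lin y p| <= C * `|lin x p|.

Lemma dom_equivalent {V W} (x : nat -> V) (y : nat -> W) :
  equivalent Num.norm x Num.norm y ->
  exists C, [/\ 1 <= C, dom C x y & dom C y x].
Proof.
move=> [C C1 xy]; have C0 : 0 < C by exact: lt_le_trans C1.
exists C; split=> // p; have [] := xy (size p) (nth 0 p); rewrite -!lin_poly !coefK //.
by rewrite mulrC ler_pdivrMr// mulrC.
Qed.

Lemma dom_le {V W} C D (x : nat -> V) (y : nat -> W) : C <= D -> dom C x y -> dom D x y.
Proof.
by move=> CD xy p; apply: le_trans (xy p) _; rewrite ler_wpM2r.
Qed.

Lemma dom_trans {U V W : normedModType R} C D (x : nat -> U) (y : nat -> V) (z : nat -> W) :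
  0 <= D -> dom C x y -> dom D y z -> dom (D * C) x z.
Proof.
move=> D0 xy yz p; apply: le_trans (yz p) _.
by rewrite -mulrA ler_wpM2l.
Qed.

Lemma dom_subseq {V W} C (x : nat -> V) (y : nat -> W) s :
  dom C x y -> dom C (x \o s) (y \o s).
Proof. by move=> xy p; rewrite (lin_subseq x s) (lin_subseq y s); exact: xy. Qed.

End Domination.

Section Blocks.
Context {R : realType} {X : normedModType R}.
Implicit Types (e x : nat -> X).

Lemma expands_lin e (p : {poly R}) : expands e (lin e p) (nth 0 p).
Proof. by exists (size p) => [j|//]; exact: nth_default. Qed.

Lemma bb_lin e (g : nat -> {poly R}) :
  (forall i, `|lin e (g i)| = 1) ->
  (forall i j, (i < j)%N -> supp_lt (nth 0 (g i)) (nth 0 (g j))) ->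
  bb e (fun i => lin e (g i)).
Proof.
move=> g1 glt; exists (fun i => nth 0 (g i)); split=> [i _|i j _ _]; last exact: glt.
by split=> //; exact: expands_lin.
Qed.

Lemma supp_lt_size (p q : {poly R}) n :
  (size p <= n)%N -> (forall i, (i < n)%N -> q`_i = 0) -> supp_lt (nth 0 p) (nth 0 q).
Proof.
move=> pn qn j k pj qk; apply: (@leq_trans n).
  by apply: leq_trans pn; rewrite ltnNge; apply: contra_neqN pj => /(nth_default 0).
by rewrite leqNgt; apply: contra_neqN qk => /qn.
Qed.

Lemma bb_subseq e x s : bb e x -> increasing s -> bb e (x \o s).
Proof.
move=> [c [xc clt]] si; exists (c \o s); split=> [i _|i j _ _ ij]; first exact: xc.
by apply: clt => //; exact: si.
Qed.

End Blocks.

(** * Subsymmetry *)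

Definition subsymmetric {R : realType} {V : normedModType R} (C : R) (e : nat -> V) : Prop :=
  forall s t, increasing s -> increasing t -> dom C (e \o s) (e \o t).

Definition unconditional {R : realType} {V : normedModType R} (C : R) (e : nat -> V) : Prop :=
  forall P p, `|lin e (keep P p)| <= C * `|lin e p|.

Section Rosenthal.
Context {R : realType} {X : normedModType R}.
Implicit Types (e x : nat -> X).

Lemma lin_MXn {V : lmodType R} (x : nat -> V) p n :
  lin x (p * 'X^n) = lin (fun i => x (i + n)%N) p.
Proof. by rewrite -spreadMXn -lin_subseq. Qed.

Lemma bb_id e : (forall i, `|e i| = 1) -> bb e e.
Proof.
move=> e1; rewrite (_ : e = fun i => lin e 'X^i); last first.
  by apply/funext => i; rewrite linX.
rewrite {1}(_ : (fun i => _) = e); last by apply/funext => i; rewrite linX.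
apply: bb_lin => [i|i j ij]; first by rewrite linX.
apply: (@supp_lt_size _ _ _ i.+1); first by rewrite size_polyXn.
by move=> k ki; rewrite coefXn ltn_eqF//; apply: leq_trans ij.
Qed.

(** Ramsey gives a finite [b] and an infinite [M] such that all sequences extending [b] in [M]
    satisfy one equivalence constant. An arbitrary subsequence need not run in [M]; it is carried
    there by a subsequence [v] with [e \o v] equivalent to [e]. *)
Lemma rosenthal_subsymmetric e : rosenthal_basis e ->
  exists2 C, 1 <= C & subsymmetric C e.
Proof.
move=> [_ e1 eR]; have ee : bb e e by exact: bb_id.
pose E (D : nat) : set (nat -> nat) :=
  [set s : nat -> nat | dom D%:R e (e \o s) /\ dom D%:R (e \o s) e].
have Ecl D s : ~ E D s -> exists n, forall s', (forall i, (i < n)%N -> s' i = s i) -> ~ E D s'.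
  move=> nE.
  (* A failed domination is witnessed by one finitely supported [p], which sees only the first
     [size p] values of [s]; this is why [E D] is closed. *)
  have [p np] : exists p, ~ (`|lin (e \o s) p| <= D%:R * `|lin e p| /\
                          `|lin e p| <= D%:R * `|lin (e \o s) p|).
    apply: contrapT => np; apply: nE; split=> p;
    by apply: contrapT => nn; apply: np; exists p => -[].
  exists (size p) => s' s's [/(_ p) l1 /(_ p) l2]; apply: np.
  have ls : lin (e \o s) p = lin (e \o s') p.
    by apply: eq_lin => i /s's /= ->.
  by rewrite ls; split.
have Ecov M : unbounded M -> exists s, [/\ increasing s, forall i, M (s i) &
     exists D0, forall D, (D0 <= D)%N -> E D s].
  move=> /unbounded_enum[u ui uM].
  have [t ti /dom_equivalent[C [C1 ut tu]]] := eR _ (bb_subseq _ _ u ee ui).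
  exists (u \o t); split; [exact: increasing_comp|by move=> i; exact: uM|].
  exists (Num.truncn C).+1 => D D0.
  have CD : C <= D%:R.
    by apply: le_trans (ltW (truncnS_gt C)) _; rewrite ler_nat.
  split; first exact: dom_le tu.
  exact: dom_le ut.
have [D [b [M [bs Mu bM]]]] := ramsey_closed_cover E Ecl Ecov.
(* The first [r] terms of an extension are those of [b], so the comparison is between its tail and
   the tail [er] of the basis. *)
pose r := size b; pose er := fun i => e (i + r)%N.
have sE s : increasing s -> (forall i, (M `&` above b) (s i)) ->
    dom D%:R er (e \o s) /\ dom D%:R (e \o s) er.
  move=> si sM; pose s' i := if (i < r)%N then nth 0%N b i else s (i - r)%N.
  have sE : E D s'.
    apply: bM; split=> [i j ij|i ib|i bi]; rewrite /s'; last 2 first.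
    - by rewrite ib.
    - by rewrite ltnNge bi /=; exact: (sM _).1.
    case: ifPn => ir; case: ifPn => jr.
    - exact: (sorted_ltn_nth ltn_trans 0%N bs).
    - by apply: (sM _).2; exact: mem_nth.
    - by rewrite (ltn_trans ij jr) in ir.
    - by apply: si; rewrite -!leqNgt in ir jr; rewrite ltn_sub2r// (leq_ltn_trans ir ij).
  have s'r p : lin (e \o s') (p * 'X^r) = lin (e \o s) p.
    rewrite lin_MXn; apply: eq_lin => i _ /=.
    by rewrite /s' ltnNge leq_addl /= addnK.
  have [E1 E2] := sE; split=> p; rewrite -s'r -lin_MXn; [exact: E1|exact: E2].
(* The chain is [e \o s], [e \o (v \o s)], [er], [e \o (v \o s')], [e \o s']: the outer links cost
   [C], the inner ones [D]. *)
have [u ui uM] := unbounded_enum _ (unbounded_above b M Mu).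
have [t ti /dom_equivalent[C [C1 ut tu]]] := eR _ (bb_subseq _ _ u ee ui).
have C0 : 0 <= C by exact: le_trans C1.
pose v := u \o t; have vi : increasing v by exact: increasing_comp.
have vM s i : (M `&` above b) ((v \o s) i) by exact: uM.
exists (Num.max 1 (C * (D%:R * (D%:R * C)))); first by rewrite le_max lexx.
move=> s s' si s'i; apply: (@dom_le _ _ _ (C * (D%:R * (D%:R * C)))).
  by rewrite le_max lexx orbT.
have svi : increasing (v \o s) by exact: increasing_comp.
have svi' : increasing (v \o s') by exact: increasing_comp.
apply: (@dom_trans _ _ _ _ _ _ _ (e \o (v \o s'))) => //; last exact: (dom_subseq _ _ _ s' ut).
apply: (@dom_trans _ _ _ _ _ _ _ er) => //; last by apply: (sE _ svi' _).1.
apply: (@dom_trans _ _ _ _ _ _ _ (e \o (v \o s))) => //; last by apply: (sE _ svi _).2.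
exact: (dom_subseq _ _ _ s tu).
Qed.

Lemma subsymmetric_subseq C e s : increasing s -> subsymmetric C e -> subsymmetric C (e \o s).
Proof. by move=> si eC t u ti ui; apply: (eC (s \o t) (s \o u)); apply: increasing_comp. Qed.

Lemma increasing_id : increasing id. Proof. by []. Qed.

Lemma subsymmetric_spread C e s p : subsymmetric C e -> increasing s ->
  `|lin e (spread s p)| <= C * `|lin e p| /\ `|lin e p| <= C * `|lin e (spread s p)|.
Proof.
move=> eC si; rewrite -lin_subseq.
by split; [exact: (eC id s increasing_id si)|exact: (eC s id si increasing_id)].
Qed.

End Rosenthal.

(** * Unconditionality *)

Definition differences {R : realType} {V : lmodType R} (e : nat -> V) : nat -> V :=
  fun i => e i.*2 - e i.*2.+1.

Section Unconditional.
Context {R : realType} {X : normedModType R}.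
Implicit Types (e x : nat -> X) (p : {poly R}).

Lemma coef_poly_mul (c : nat -> R) p i :
  (\poly_(j < size p) (p`_j * c j))`_i = p`_i * c i.
Proof. by rewrite coef_poly; case: ltnP => // ?; rewrite nth_default ?mul0r. Qed.

Lemma lin_differences {V : lmodType R} (e : nat -> V) p :
  lin (differences e) p = lin e (lin (differences (fun i => 'X^i)) p).
Proof.
rewrite [RHS]lin_lin; apply: eq_lin => i _.
by rewrite /differences linearB /= !linX.
Qed.

(** Subsymmetry allows the pairs outside [P] to be moved while the others stay fixed. The average of
    such a pair over [N] consecutive positions telescopes to a vector of size at most 2/N. One
    factor [C] pays for moving the pairs, the other for moving back. *)
Lemma differences_unconditional C e :
  subsymmetric C e -> (forall i, `|e i| <= 1) -> 0 <= C ->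
  unconditional (C ^+ 2) (differences e).
Proof.
move=> eC e1 C0 P p.
pose d := differences e.
have dC s q : increasing s -> `|lin (differences (e \o s)) q| <= C * `|lin d q| /\
    `|lin d q| <= C * `|lin (differences (e \o s)) q|.
  move=> si; rewrite (lin_differences e) (lin_differences (e \o s)).
  rewrite (lin_subseq e s); exact: subsymmetric_spread.
have tele (f : nat -> X) M : \sum_(k < M) (f k - f k.+1) = f 0%N - f M.
  elim: M => [|M IH]; first by rewrite big_ord0 subrr.
  by rewrite big_ord_recr /= IH addrA subrK.
pose B := \sum_(i < size p) `|p`_i|.
have main N : (0 < N)%N ->
    `|lin d (keep P p)| <= C ^+ 2 * `|lin d p| + C * (2 * B) / N%:R.
  move=> N0; have NR0 : 0 < N%:R :> R by rewrite ltr0n.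
  (* The pair with index [i] is moved [k] steps to the right inside its window
     when [~~ P i]; averaging over [k < N] telescopes these pairs away. *)
  pose s k l := (l./2 * N.+2 + (if P l./2 then 0 else k) + odd l)%N.
  have si k : (k < N)%N -> increasing (s k).
    move=> kN; apply: increasingS => l; rewrite /s /= uphalf_half.
    case: (odd l); last by rewrite add0n addn0 addn1.
    rewrite /= add1n addn0 mulSn addn1.
    set a := (_ * _)%N; set b := if P l./2 then _ else _.
    have bk : (b <= k)%N by rewrite /b; case: ifP.
    by set c := if P _ then _ else _; lia.
  pose r i := if P i then 0 else e (i * N.+2)%N - e (i * N.+2 + N)%N.
  have sumE i : \sum_(k < N) differences (e \o s k) i =
      N%:R *: (if P i then differences (e \o s 0%N) i else 0) + r i.
    rewrite /differences /s /r /= doubleK uphalf_double odd_double !addn0 addn1.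
    case: ifP => Pi.
      by rewrite !if_same !addn0 addn1 addr0 sumr_const card_ord scaler_nat.
    rewrite scaler0 add0r; under eq_bigr => k _ do rewrite /= addn0 addn1 -addnS.
    by rewrite (tele (fun k => e (i * N.+2 + k)%N)) addn0.
  have avg : N%:R * `|lin (differences (e \o s 0%N)) (keep P p)| <=
      N%:R * (C * `|lin d p|) + 2 * B.
    have -> : N%:R * `|lin (differences (e \o s 0%N)) (keep P p)| =
        `|\sum_(k < N) lin (differences (e \o s k)) p - lin r p|.
      rewrite -lin_sum -linB lin_keep -[X in X * _]ger0_norm ?ler0n// -normrZ; congr `|_|.
      rewrite /lin scaler_sumr; apply: eq_bigr => i _.
      by rewrite sumE addrK !scalerA mulrC.
    apply: le_trans (ler_normB _ _) _; apply: lerD.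
      apply: le_trans (ler_norm_sum _ _ _) _.
      rewrite mulr_natl -[X in _ *+ X]card_ord -sumr_const.
      by apply: ler_sum => k _; apply: (dC _ p (si k _)).1.
    rewrite mulr_sumr; apply: le_trans (ler_norm_sum _ _ _) _.
    apply: ler_sum => i _; rewrite normrZ mulrC ler_wpM2r// /r.
    case: ifP => _; first by rewrite normr0.
    by apply: le_trans (ler_normB _ _) _; rewrite (_ : 2 = 1 + 1)// lerD.
  apply: le_trans (dC _ _ (si 0%N N0)).2 _.
  rewrite (_ : _ + _ = C * (C * `|lin d p| + 2 * B / N%:R)); last first.
    by rewrite mulrDr expr2 !mulrA.
  rewrite ler_wpM2l// -(ler_pM2l NR0) mulrDr [X in _ <= _ + X]mulrC divfK//.
  by rewrite gt_eqF.
apply/ler_addgt0Pr => eps eps0.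
(* This [N] is large enough to bring the error term below [eps]. *)
pose N := (Num.truncn (C * (2 * B) / eps)).+1.
apply: le_trans (main N isT) _; rewrite lerD2l ler_pdivrMr ?ltr0n//.
by rewrite -ler_pdivrMl// mulrC ltW// truncnS_gt.
Qed.

Lemma schauder_independent e p : schauder_basis e -> lin e p = 0 -> p = 0.
Proof.
move=> eS p0; have [c [_ cu]] := eS 0.
have cp : c = nth 0 p.
  apply: cu; apply: cvg_near_cst; exists (size p) => // n /= pn.
  by rewrite /series /= big_mkord -(lin_widen n e p pn).
have c0 : c = (fun=> 0).
  apply: cu; apply: cvg_near_cst; exists 0%N => // n _.
  by rewrite /series /= big1// => i _; rewrite scale0r.
by apply/polyP => i; rewrite coef0 -cp c0.
Qed.

(** The normalized differences form a block basis, so a subsequence of them is equivalent to [e] and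
    transfers its unconditionality. The normalizing factors only rescale coefficients, which
    commutes with [keep]. *)
Lemma rosenthal_unconditional e : rosenthal_basis e ->
  exists2 C, 1 <= C & unconditional C e.
Proof.
move=> eR; have [C C1 eC] := rosenthal_subsymmetric e eR.
have [eS e1 eb] := eR; have C0 : 0 < C by exact: lt_le_trans C1.
pose q i : {poly R} := 'X^(i.*2) - 'X^(i.*2.+1).
have lq i : lin e (q i) = differences e i by rewrite linearB /= !linX.
have m_gt0 i : 0 < `|lin e (q i)|.
  have si : increasing (fun l => l + i.*2)%N by move=> j k; rewrite ltn_add2r.
  have := (subsymmetric_spread _ _ _ (q 0%N) eC si).2.
  rewrite spreadMXn mulrBl -!exprD add0n double0 addSn add0n -/(q i) => le0.
  rewrite -(pmulr_rgt0 _ C0); apply: lt_le_trans le0.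
  rewrite normr_gt0; apply/negP => /eqP/(schauder_independent _ _ eS).
  move=> /(congr1 (fun p : {poly R} => p`_0)).
  by rewrite coefB !coefXn coef0 subr0 => /eqP; rewrite oner_eq0.
pose c i := `|lin e (q i)|^-1.
have dE i : lin e (c i *: q i) = c i *: differences e i.
  by rewrite linearZ /= lq.
have [|s si /dom_equivalent[C' [C'1 de ed]]] := eb (fun i => lin e (c i *: q i)).
  apply: bb_lin => [i|i j ij].
    by rewrite linearZ normrZ ger0_norm ?invr_ge0// mulVf// gt_eqF.
  apply: (@supp_lt_size _ _ _ i.+1.*2) => [|k ki].
    apply: leq_trans (size_scale_leq _ _) _.
    apply: leq_trans (size_polyD _ _) _; rewrite size_polyN.
    by rewrite !size_polyXn geq_max doubleS !ltnS leqnSn leqnn.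
  have kj : (k < j.*2)%N by rewrite (leq_trans ki)// leq_double.
  by rewrite coefZ coefB !coefXn !ltn_eqF ?subr0 ?mulr0// ltnW.
(* [u] lists the two members of each pair selected by [s], so the differences of [e \o u] are the
   chosen differences of [e]. *)
pose u l := ((s l./2).*2 + odd l)%N.
have ui : increasing u.
  apply: increasingS => l; rewrite /u /= uphalf_half.
  have := si l./2 l./2.+1 (ltnSn _).
  by case: (odd l) => /=; rewrite ?add1n ?add0n; lia.
have uC := differences_unconditional C (e \o u) (subsymmetric_subseq _ _ _ ui eC)
   (fun i => ltac:(by rewrite /= e1)) (ltW C0).
have us : differences (e \o u) = differences e \o s.
  apply/funext => i; rewrite /differences /= /u /= doubleK uphalf_double odd_double.
  by rewrite addn0 addn1.
have C'0 : 0 < C' by exact: lt_le_trans C'1.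
have sE p : lin ((fun i => lin e (c i *: q i)) \o s) p =
    lin (differences e \o s) (\poly_(i < size p) (p`_i * c (s i))).
  by rewrite -linZ; apply: eq_lin => i _ /=; rewrite dE.
exists (C' * (C ^+ 2 * C')).
  by rewrite mulr_ege1// mulr_ege1// exprn_ege1.
move=> P p; apply: le_trans (de _) _; rewrite -mulrA ler_wpM2l ?(ltW C'0)//.
apply: (@le_trans _ _ (C ^+ 2 * `|lin ((fun i => lin e (c i *: q i)) \o s) p|)); last first.
  by rewrite -[leRHS]mulrA ler_wpM2l ?sqr_ge0//; exact: ed.
rewrite !sE -us; apply: le_trans (uC P _).
rewrite le_eqVlt; apply/orP; left; apply/eqP; congr `|lin _ _|.
apply/polyP => i; rewrite (coef_poly_mul (c \o s)) !coef_keep (coef_poly_mul (c \o s)).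
by case: ifP => _; rewrite ?mul0r.
Qed.

End Unconditional.

(** As a polynomial this is c(X) b(X^n): copies of [c] with weights [b] on consecutive intervals of
    length [n], disjoint when [size c <= n]. *)
Definition tensor {R : realType} n (b c : {poly R}) : {poly R} :=
  lin (fun j => c * 'X^(j * n)) b.

(** * Monotonicity of the norm in the coefficients, and displacement of interval copies *)

Section Lattice.
Context {R : realType} {X : normedModType R}.
Implicit Types (e x : nat -> X) (p q : {poly R}).

(** The norm is convex in each [t i] separately, so the coordinates can be pushed one by one to an
    end point of [0, 1]; [w] carries the terms already treated. *)
Lemma exists_extreme_point x (t : nat -> R) n w : (forall i, 0 <= t i <= 1) ->
  exists P : pred nat, `|\sum_(i < n) t i *: x i + w| <=
                       `|\sum_(i < n) (if P i then x i else 0) + w|.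
Proof.
move=> t01; elim: n w => [|n IH] w; first by exists xpredT; rewrite !big_ord0.
have [b le_b] : exists b : bool, `|\sum_(i < n) t i *: x i + (t n *: x n + w)| <=
    `|\sum_(i < n) t i *: x i + ((if b then x n else 0) + w)|.
  set u := \sum_(i < n) _; have /andP[t0 t1] := t01 n.
  have -> : u + (t n *: x n + w) = (1 - t n) *: (u + w) + t n *: (u + (x n + w)).
    rewrite [u + (t n *: _ + w)]addrCA [u + (x n + w)]addrCA.
    move: (u + w) => v; rewrite scalerBl scale1r.
    by rewrite scalerDr [RHS]addrC -addrA [X in _ = _ + X]addrCA subrr addr0.
  have bnd M : `|u + w| <= M -> `|u + (x n + w)| <= M ->
      `|(1 - t n) *: (u + w) + t n *: (u + (x n + w))| <= M.
    move=> le1 le2; apply: le_trans (ler_normD _ _) _.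
    rewrite !normrZ (ger0_norm t0) ger0_norm ?subr_ge0//.
    rewrite -[leRHS](_ : (1 - t n) * M + t n * M = M); last by rewrite -mulrDl subrK mul1r.
    by rewrite lerD// ler_wpM2l// subr_ge0.
  have [le1|/ltW le1] := leP `|u + w| `|u + (x n + w)|.
    by exists true; exact: bnd.
  by exists false; rewrite add0r; exact: bnd.
have [P PP] := IH ((if b then x n else 0) + w).
exists (fun i => if i == n then b else P i).
rewrite !big_ord_recr /= eqxx -!addrA; apply: le_trans le_b _.
rewrite (eq_bigr (fun i : 'I_n => if P i then x i else 0))//.
by move=> i _; rewrite ltn_eqF.
Qed.

Lemma unconditional_le C e p q : unconditional C e -> (forall i, `|p`_i| <= `|q`_i|) ->
  `|lin e p| <= (2 * C + 1) * `|lin e q|.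
Proof.
move=> eC pq; pose n := maxn (size p) (size q).
have pn : (size p <= n)%N by rewrite leq_maxl.
have qn : (size q <= n)%N by rewrite leq_maxr.
(* Here p = (2t - 1) q coordinatewise, whence the constant 2C + 1. Where [q] vanishes so does [p],
   and the default value of the division gives t = 1/2. *)
pose t i := (p`_i / q`_i + 1) / 2.
have t01 i : 0 <= t i <= 1.
  have : `|p`_i / q`_i| <= 1.
    rewrite normrM normfV; have [->|q0] := eqVneq q`_i 0; first by rewrite normr0 invr0 mulr0.
    by rewrite ler_pdivrMr ?normr_gt0// mul1r.
  rewrite ler_norml /t => /andP[? ?]; apply/andP; split; lra.
have [P] := exists_extreme_point (fun i => q`_i *: e i) t n 0 t01.
rewrite !addr0.
have -> : \sum_(i < n) (if P i then q`_i *: e i else 0) = lin e (keep P q).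
  rewrite lin_keep (lin_widen n)//; apply: eq_bigr => i _.
  by case: ifP => //; rewrite scaler0.
move=> le_P; have {le_P} := le_trans le_P (eC P q).
have -> : lin e p = 2 *: (\sum_(i < n) t i *: (q`_i *: e i)) - lin e q.
  rewrite (lin_widen n e p pn) (lin_widen n e q qn) scaler_sumr -sumrB.
  apply: eq_bigr => i _; rewrite !scalerA -scalerBl; congr (_ *: _).
  rewrite /t; have [q0|q0] := eqVneq q`_i 0; last by field.
  by have := pq i; rewrite q0 normr0 normr_le0 => /eqP ->; rewrite !mulr0 subr0.
move=> le_C; apply: le_trans (ler_normB _ _) _.
rewrite mulrDl mul1r lerD2r normrZ ger0_norm// -mulrA.
by rewrite ler_wpM2l.
Qed.

(** The index map sends the [j]-th interval of length [n] to the one starting at [u j]; with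
    subsymmetry, the positions of the copies of [c] matter only up to a constant. *)
Lemma spread_tensor n (u : nat -> nat) (b c : {poly R}) : (size c <= n)%N -> (0 < n)%N ->
  spread (fun l => u (l %/ n) + l %% n)%N (tensor n b c) = lin (fun j => c * 'X^(u j)) b.
Proof.
move=> cn n0; rewrite /spread lin_lin; apply: eq_lin => j _.
rewrite -!spreadMXn /spread lin_lin; apply: eq_lin => i ic.
rewrite linX; congr 'X^_.
have ilt : (i < n)%N by exact: leq_trans cn.
by rewrite /= [(i + j * n)%N]addnC divnMDl// modnMDl divn_small// modn_small// addn0 addnC.
Qed.

Lemma increasing_divn_modn n (u : nat -> nat) : (0 < n)%N ->
  (forall j, u j + n <= u j.+1)%N -> increasing (fun l => u (l %/ n) + l %% n)%N.
Proof.
move=> n0 un; apply: increasingS => l.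
have lt_n := ltn_pmod l n0.
have [lt|ge] := ltnP (l %% n).+1 n.
  have lS : l.+1 = (l %/ n * n + (l %% n).+1)%N by rewrite addnS -divn_eq.
  by rewrite lS divnMDl// modnMDl (divn_small lt) (modn_small lt) addn0 ltn_add2l.
have lS : l.+1 = ((l %/ n).+1 * n)%N by rewrite {1}(divn_eq l n) mulSn; lia.
by rewrite lS mulnK// modnMl addn0; apply: leq_trans (un _); rewrite ltn_add2l.
Qed.

End Lattice.

(** * Uniform domination *)

(** For [x] in [bb e] this describes the basic open set [a, A] of [bbE e] whose [a] is the prefix of
    [x] of length [m] and whose [A] is the remaining tail. *)
Definition neighbour {R : realType} {X : normedModType R} (x : nat -> X) m (z : nat -> X) : Prop :=
  (forall i, (i < m)%N -> z i = x i) /\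
  bb (fun k => x (k + m)%N) (fun k => z (k + m)%N).

Section Fusion.
Context {R : realType} {X : completeNormedModType R}.
Implicit Types (e x : nat -> X) (p q : {poly R}).

Lemma nbhs_bbD_prefix e (y : bbD e) n :
  nbhs y [set z : bbD e | forall i, (i < n)%N -> set_val z i = set_val y i].
Proof.
elim: n => [|n IH]; first by apply: filterE.
have near_n : nbhs y [set z : bbD e | set_val z n = set_val y n].
  have c1 : continuous (set_val : bbD e -> prod_topology (fun _ : nat => discrete_topology X)).
    exact: initial_continuous.
  have c2 := @proj_continuous nat (fun _ => discrete_topology X) n.
  have c3 := @continuous_comp _ _ _ _ _ y (c1 y) (c2 (set_val y)).
  apply: (c3 [set v | v = set_val y n]).
  by rewrite nbhs_principalE; apply/principal_filterP.
apply: filterS (filterI IH near_n) => z [zy zyn] i.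
by rewrite ltnS leq_eqVlt => /predU1P[->|/zy].
Qed.

(** A basic set [a, A] containing [x] also contains every neighbour of [x] of order at least
    [size a]; [m0] allows the order to be as large as a construction requires. *)
Lemma continuous_prefix e (phi : bb e -> bb e) :
  continuous (phi : bbE e -> bbD e) -> forall (x : bb e) n m0,
  exists2 m, (m0 <= m)%N & forall z : bb e, neighbour (set_val x) m (set_val z) ->
    forall i, (i < n)%N -> set_val (phi z) i = set_val (phi x) i.
Proof.
move=> cphi x n m0.
have := cphi x _ (nbhs_bbD_prefix e (phi x) n).
rewrite nbhsE => -[B [[D' D'sub <-] [[a A] D'aA aAx]] Bsub].
exists (maxn m0 (size a)); first exact: leq_maxl.
set m := maxn _ _ => z [zx zb].
have ex : bb e (set_val x) by exact: set_valP.
apply: (Bsub z); exists (a, A) => //.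
pose b := mkseq (set_val x) m.
have bm : size b = m by rewrite size_mkseq.
apply: (@basicE_sub _ _ e a b A x (fun k => set_val x (k + m)%N)) => //.
- by rewrite bm leq_maxr.
- apply/funext => i; rewrite /concat bm; case: ltnP => im; first by rewrite nth_mkseq.
  by rewrite subnK.
- exists (fun k => set_val z (k + m)%N) => //.
  apply/funext => i; rewrite /concat /= bm; case: ltnP => im; last by rewrite subnK.
  by rewrite nth_mkseq// zx.
Qed.

Lemma bb_polys e x : bb e x -> exists g : nat -> {poly R},
  [/\ forall i, x i = lin e (g i), forall i, `|x i| = 1 &
      forall i j, (i < j)%N -> supp_lt (nth 0 (g i)) (nth 0 (g j))].
Proof.
move=> [c [xc clt]].
have /choice[g gP] : forall i, exists g : {poly R}, x i = lin e g /\ nth 0 g = c i.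
  move=> i; have [_ [n cn xn]] := xc i I; exists (\poly_(j < n) c i j).
  split; first by rewrite lin_poly.
  by apply/funext => j; rewrite coef_poly; case: ltnP => // /cn.
exists g; split=> [i|i|i j ij]; [exact: (gP i).1|exact: (xc i I).1|].
by rewrite (gP i).2 (gP j).2; exact: clt.
Qed.

Definition independent x : Prop := forall p, lin x p = 0 -> p = 0.

Lemma independent_bb e x : independent e -> bb e x -> independent x.
Proof.
move=> eI /bb_polys[g [xg x1 glt]] p p0.
have {}p0 : lin g p = 0.
  by apply: eI; rewrite lin_lin -p0; apply: eq_lin => i _; rewrite xg.
apply/polyP => i; rewrite coef0.
have [ip|/(nth_default 0)//] := ltnP i (size p).
have gi0 : g i != 0.
  by apply/eqP => gi; have := x1 i; rewrite xg gi linear0 normr0 => /esym/eqP; rewrite oner_eq0.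
(* The position of the leading coefficient of [g i] lies in the support of no other block, so
   reading the combination there isolates the coefficient of [p] at [i]. *)
have := congr1 (fun q : {poly R} => q`_(size (g i)).-1) p0.
rewrite coef0 coef_lin (bigD1 (Ordinal ip)) //= big1 ?addr0 => [/eqP|k ki].
  by rewrite mulf_eq0 -[_`_(size _).-1]/(lead_coef _) lead_coef_eq0 (negPf gi0) orbF => /eqP.
apply/eqP; rewrite mulf_eq0; apply/orP; right; apply/negPn/negP => gk.
have gl : (g i)`_(size (g i)).-1 != 0 by rewrite -[_`_(size _).-1]/(lead_coef _) lead_coef_eq0.
have [ki'|ik|ik] := ltngtP k i.
- by have := glt _ _ ki' _ _ gk gl; rewrite ltnn.
- by have := glt _ _ ik _ _ gl gk; rewrite ltnn.
- by move: ki; rewrite -val_eqE /= ik eqxx.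
Qed.

(** Each approximant brings its own coefficients. Independence forces them to agree, so they can be
    read on the diagonal [g i.+1 i]. *)
Lemma bb_limit e x : independent e ->
  (forall n, exists2 z, bb e z & forall i, (i < n)%N -> z i = x i) -> bb e x.
Proof.
move=> eI zx.
have /choice[g gP] : forall n, exists g : nat -> {poly R},
    [/\ forall i, (i < n)%N -> x i = lin e (g i), forall i, (i < n)%N -> `|x i| = 1 &
      forall i j, (i < j)%N -> supp_lt (nth 0 (g i)) (nth 0 (g j))].
  move=> n; have [z /bb_polys[g [zg z1 glt]] zn] := zx n.
  by exists g; split=> // i /zn <-.
have xg i : x i = lin e (g i.+1 i) by have [+ _ _] := gP i.+1; apply.
rewrite (_ : x = fun i => lin e (g i.+1 i)); last exact/funext.
apply: bb_lin => [i|i j ij]; first by rewrite -xg; have [_ + _] := gP i.+1; apply.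
suff -> : g i.+1 i = g j.+1 i by have [_ _] := gP j.+1; apply.
apply/eqP; rewrite -subr_eq0; apply/eqP/eI; rewrite linearB /= -xg.
have [xj _ _] := gP j.+1; rewrite -xj ?subrr//.
exact: ltnW.
Qed.

Lemma neighbour_trans x z w m m' : (m <= m')%N ->
  neighbour x m z -> neighbour z m' w -> neighbour x m w.
Proof.
move=> mm' [zx zb] [wz wb]; split=> [i im|].
  by rewrite wz ?zx//; exact: leq_trans im mm'.
have := @bb_graft _ _ _ (fun k => z (k + m)%N) (fun k => w (k + m')%N) (m' - m)%N zb.
set f := (X in bb X _ -> _); rewrite (_ : f = fun k => z (k + m')%N); last first.
  by apply/funext => k; rewrite /f; congr (z _); lia.
move=> /(_ wb); congr (bb _ _); apply/funext => i.
case: ltnP => im; first by rewrite wz//; lia.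
by congr (w _); lia.
Qed.

Lemma bb_shift e x m : bb e x -> bb e (fun k => x (k + m)%N).
Proof. by move=> ex; apply: (bb_subseq _ _ (addn^~ m) ex) => i j; rewrite ltn_add2r. Qed.

Lemma neighbour_refl e x m : bb e x -> neighbour x m x.
Proof. by move=> ex; split=> //; apply: bb_refl (bb_shift _ _ m ex). Qed.

(** Otherwise there are successive neighbourhoods on which domination by [phi] fails with constants
    1, 2, 3 and so on. The diagonal sequence lies in all of them, and its image dominates [e] with
    no constant. *)
Lemma uniform_domination e (phi : bb e -> bb e) :
  independent e -> (forall i, `|e i| = 1) ->
  continuous (phi : bbE e -> bbD e) ->
  (forall x : bb e, exists2 K, 0 < K & dom K (set_val (phi x)) e) ->
  exists (x : bb e) m K, 0 < K /\
    forall z : bb e, neighbour (set_val x) m (set_val z) -> dom K (set_val (phi z)) e.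
Proof.
move=> eI e1 /continuous_prefix cphi phiK; apply: contrapT => nex.
have step (xm : bb e * nat) (k : nat) : exists zm : bb e * nat,
    [/\ neighbour (set_val xm.1) xm.2 (set_val zm.1), (xm.2 < zm.2)%N &
      forall w : bb e, neighbour (set_val zm.1) zm.2 (set_val w) ->
        ~ dom k.+1%:R (set_val (phi w)) e].
  case: xm => x m /=.
  have [z xz nd] : exists2 z : bb e, neighbour (set_val x) m (set_val z) &
      ~ dom k.+1%:R (set_val (phi z)) e.
    apply: contrapT => nz; apply: nex; exists x, m, k.+1%:R; split=> // z xz.
    by apply: contrapT => nd; apply: nz; exists z.
  (* The failure at [z] is witnessed by one [p], hence by finitely many terms of [phi z]; by
     continuity it persists on a neighbourhood of [z]. *)
  have [p np] : exists p, ~ (`|lin e p| <= k.+1%:R * `|lin (set_val (phi z)) p|).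
    by apply: contrapT => np; apply: nd => p; apply: contrapT => ?; apply: np; exists p.
  have [m' mm' m'P] := cphi z (size p) m.+1; exists (z, m'); split=> //= w zw wd.
  by apply: np; have := wd p; rewrite (eq_lin (set_val (phi w)) _ p (m'P w zw)).
have /choice[f fP] := fun xmk : bb e * nat * nat => step xmk.1 xmk.2.
have [x0 _] : exists x0 : bb e, set_val x0 = e.
  by exists (SigSub (mem_set (bb_id e e1))).
pose st := fix st k := if k is k'.+1 then f (st k', k') else (x0, 0%N).
pose x k := set_val (st k).1; pose m k := (st k).2.
have xb k : bb e (x k) by exact: set_valP.
have mi : increasing m by apply: increasingS => k; have [] := fP (st k, k).
have km k : (k <= m k)%N by exact: increasing_ge.
have mle j k : (j <= k)%N -> (m j <= m k)%N.
  by apply: (homo_leq leqnn leq_trans) => i; exact/ltnW/mi.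
have xx j k : (j <= k)%N -> neighbour (x j) (m j) (x k).
  move=> /subnK <-; elim: (k - j)%N => [|i IH]; first exact: neighbour_refl (xb j).
  apply: (neighbour_trans _ _ _ _ (m (i + j)%N)) IH _; first by rewrite mle ?leq_addl.
  by have [] := fP (st (i + j)%N, (i + j)%N).
(* The [i]-th term no longer changes from stage [i.+1] on, because [i < m i.+1]. *)
pose y i := x i.+1 i.
have yx k i : (i < m k)%N -> y i = x k i.
  move=> ik; rewrite /y; have [le|/ltnW le] := leqP i.+1 k.
    by rewrite (xx _ _ le).1.
  by rewrite (xx _ _ le).1.
have yk k : neighbour (x k) (m k) y.
  split=> [i /yx//|]; apply: bb_limit.
    exact: independent_bb eI (bb_shift _ _ _ (xb k)).
  move=> n; exists (fun i => x (maxn k (n + m k)) (i + m k)%N).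
    by apply: (xx _ _ _).2; rewrite leq_maxl.
  move=> i ni; rewrite -yx//; apply: leq_trans (km _).
  by rewrite (leq_trans _ (leq_maxr _ _))// ltn_add2r.
have yb : bb e y.
  by apply: bb_limit => // n; exists (x n) => // i ni; rewrite -yx// (leq_trans ni).
have [Y Yy] : exists Y : bb e, set_val Y = y by exists (SigSub (mem_set yb)).
have [K K0 YK] := phiK Y.
have [_ _ nK] := fP (st (Num.truncn K), Num.truncn K).
apply: (nK Y); first by rewrite Yy; exact: (yk (Num.truncn K).+1).
by apply: dom_le YK; exact/ltW/truncnS_gt.
Qed.

End Fusion.

(** * Tensor products *)

Section Tensor.
Context {R : realType} {X : completeNormedModType R}.
Implicit Types (e x : nat -> X) (p q : {poly R}).

Lemma subsymmetric_MXn C e p n : subsymmetric C e ->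
  `|lin e (p * 'X^n)| <= C * `|lin e p| /\ `|lin e p| <= C * `|lin e (p * 'X^n)|.
Proof.
move=> eC; rewrite -spreadMXn; apply: subsymmetric_spread => //.
by move=> i j; rewrite ltn_add2r.
Qed.

Lemma subsymmetric_tensor C e n (u : nat -> nat) (b c : {poly R}) :
  subsymmetric C e -> (size c <= n)%N -> (0 < n)%N -> (forall j, u j + n <= u j.+1)%N ->
  `|lin e (lin (fun j => c * 'X^(u j)) b)| <= C * `|lin e (tensor n b c)| /\
  `|lin e (tensor n b c)| <= C * `|lin e (lin (fun j => c * 'X^(u j)) b)|.
Proof.
move=> eC cn n0 un; rewrite -(spread_tensor n)//.
exact: subsymmetric_spread (increasing_divn_modn n u n0 un).
Qed.

(** Normalized copies of [c] along [B], grafted onto the prefix of [x0], stay in the neighbourhood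
    of uniform domination. Hence a subsequence of them dominates [e] with a constant independent of
    [c], and undoing the normalization gives the estimate. *)
Lemma tensor_lower e (phi : bb e -> bb e) :
  rosenthal_basis e ->
  continuous (phi : bbE e -> bbD e) ->
  (forall x : bb e,
    (exists2 s : nat -> nat, increasing s & set_val (phi x) = set_val x \o s)
    /\ dominates Num.norm (set_val (phi x)) Num.norm e) ->
  exists2 D, 1 <= D & forall n (b c : {poly R}), (size c <= n)%N ->
    `|lin e b| * `|lin e c| <= D * `|lin e (tensor n b c)|.
Proof.
move=> eR cphi phiP; have [eS e1 eb] := eR.
have eI : independent e by move=> p; apply: schauder_independent.
have [C1 C1_1 eC1] := rosenthal_subsymmetric e eR.
have [C2 C2_1 eC2] := rosenthal_unconditional e eR.
have C10 : 0 < C1 by exact: lt_le_trans C1_1.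
have C20 : 0 < C2 by exact: lt_le_trans C2_1.
have phiK (x : bb e) : exists2 K, 0 < K & dom K (set_val (phi x)) e.
  have [_ [K K0 KP]] := phiP x; exists K => // p.
  by have := KP (size p) (nth 0 p); rewrite -!lin_poly !coefK.
have [x0 [m0 [K [K0 xK]]]] := uniform_domination e phi eI e1 cphi phiK.
have x0b : bb e (set_val x0) by exact: set_valP.
pose A k := set_val x0 (k + m0)%N.
have Ab : bb e A by exact: bb_shift.
have [s si /dom_equivalent[C0 [C0_1 Be eB]]] := eb A Ab.
have C00 : 0 < C0 by exact: lt_le_trans C0_1.
pose B := A \o s.
have AB : bb A B by apply: bb_subseq => //; exact: bb_refl Ab.
(* [C1 * C0] bounds the norms of the copies from below, [2 * C2 + 1] compares coefficients, and the
   last factor comes from the domination and the return from [B] to [e]. *)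
pose D := C1 * C0 * ((2 * C2 + 1) * (C1 * (K * (C0 * C1)))).
exists (Num.max 1 D); first by rewrite le_max lexx.
move=> n b c cn.
suff main : `|lin e b| * `|lin e c| <= D * `|lin e (tensor n b c)|.
  by apply: le_trans main _; rewrite ler_wpM2r// le_max lexx orbT.
have D0 : 0 <= D by rewrite !mulr_ge0// ?ltW// addr_gt0// mulr_gt0.
have [c0|c0] := eqVneq c 0; first by rewrite c0 linear0 normr0 mulr0 mulr_ge0.
have n0 : (0 < n)%N by apply: leq_trans cn; rewrite size_poly_gt0.
pose q j := c * 'X^(j * n).
pose mu j := `|lin B (q j)|.
have mu_ge j : `|lin e c| <= C1 * C0 * mu j.
  apply: le_trans (subsymmetric_MXn _ _ c (j * n) eC1).2 _.
  by rewrite -mulrA ler_wpM2l ?(ltW C10)//; exact: Be.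
have Nc : 0 < `|lin e c|.
  by rewrite normr_gt0; apply: contra_neqN c0 => /eqP/eI.
have mu0 j : 0 < mu j.
  have := lt_le_trans Nc (mu_ge j); rewrite pmulr_rgt0//; exact: mulr_gt0.
pose z j := lin B ((mu j)^-1 *: q j).
have zB : bb B z.
  apply: bb_lin => [j|i j ij].
    by rewrite linearZ normrZ ger0_norm ?invr_ge0 ?(ltW (mu0 _))// mulVf// gt_eqF.
  apply: (@supp_lt_size _ _ _ (i.+1 * n)) => [|k ki].
    apply: leq_trans (size_scale_leq _ _) _; rewrite size_Mmonic ?monicXn//.
    by rewrite size_polyXn addnS /= mulSn leq_add2r.
  rewrite coefZ coefMXn ifT ?mulr0//; apply: leq_trans ki _.
  by rewrite leq_mul2r ij orbT.
have Az : bb A z by exact: bb_trans AB zB.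
have wb := bb_graft x0b Az.
set w := (X in bb e X) in wb.
have [W Ww] : exists W : bb e, set_val W = w by exists (SigSub (mem_set wb)).
have x0w : neighbour (set_val x0) m0 w.
  split=> [i im|]; first by rewrite /w im.
  rewrite (_ : (fun k => w _) = z)//; apply/funext => k.
  by rewrite /w ltnNge leq_addl /= addnK.
have [[t ti phiW] _] := phiP W.
have Wdom : dom K (w \o t) e.
  by rewrite -Ww -phiW; apply: xK; rewrite Ww.
have tm i : (m0 <= t (i + m0))%N.
  by apply: leq_trans (increasing_ge _ ti _); rewrite leq_addl.
(* Since [t (i + m0)] is at least [m0], dropping [m0] terms of [w \o t] leaves only terms of [z],
   with indices [tau]. *)
pose tau i := (t (i + m0) - m0)%N.
have taui : increasing tau.
  move=> i j ij; have := ti (i + m0)%N (j + m0)%N; rewrite ltn_add2r => /(_ ij).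
  by have := tm i; rewrite /tau; lia.
have zdom p : `|lin e p| <= C1 * (K * `|lin (z \o tau) p|).
  apply: le_trans (subsymmetric_MXn _ _ p m0 eC1).2 _; rewrite ler_wpM2l ?(ltW C10)//.
  apply: le_trans (Wdom _) _; rewrite lin_MXn (eq_lin _ (z \o tau))// => i _ /=.
  by rewrite /w ltnNge tm.
(* The factors [mu] cancel the normalization in [z], so that [z \o tau] applied to [p] gives copies
   of [c] with the weights [b]. *)
pose p := \poly_(i < size b) (b`_i * mu (tau i)).
have lp : lin (z \o tau) p = lin B (lin (fun i => c * 'X^(tau i * n)) b).
  rewrite /p -(linZ _ (mu \o tau)) lin_lin; apply: eq_lin => i _ /=.
  by rewrite /z linearZ /= scalerA mulfV ?scale1r// gt_eqF.
have Np : `|lin e p| <= C1 * (K * (C0 * C1)) * `|lin e (tensor n b c)|.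
  apply: le_trans (zdom p) _; rewrite -!mulrA !ler_wpM2l ?(ltW C10) ?(ltW K0)// lp.
  apply: le_trans (eB _) _; rewrite ler_wpM2l ?(ltW C00)//.
  apply: (subsymmetric_tensor _ _ _ (fun i => tau i * n)%N _ _ eC1 cn n0 _).1.
  by move=> j; rewrite addnC -mulSn leq_mul2r taui ?orbT.
have Nb : `|lin e c| * `|lin e b| <= C1 * C0 * ((2 * C2 + 1) * `|lin e p|).
  pose b' := (`|lin e c| / (C1 * C0)) *: b.
  have CC : 0 < C1 * C0 by exact: mulr_gt0.
  have <- : C1 * C0 * `|lin e b'| = `|lin e c| * `|lin e b|.
    rewrite linearZ normrZ ger0_norm; last by rewrite divr_ge0// ltW.
    by rewrite mulrA [X in X * _]mulrC divfK// gt_eqF.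
  rewrite ler_wpM2l ?(ltW CC)//; apply: unconditional_le => // i.
  rewrite (coef_poly_mul (mu \o tau)) coefZ mulrC !normrM ler_wpM2l//.
  rewrite ger0_norm ?normr_ge0// [X in _ * X]ger0_norm ?invr_ge0 ?(ltW CC)//.
  by rewrite ger0_norm ?(ltW (mu0 _))// ler_pdivrMr// mulrC; exact: mu_ge.
rewrite mulrC; apply: le_trans Nb _; rewrite /D -!mulrA.
rewrite !ler_wpM2l ?(ltW C10) ?(ltW C00)//; first by rewrite addr_ge0// mulr_ge0// ltW.
by apply: le_trans Np _; rewrite -!mulrA.
Qed.

End Tensor.

(** * The upper estimate for tensor products *)

Section TensorUpper.
Context {R : realType} {X : completeNormedModType R}.
Implicit Types (e x : nat -> X) (p q : {poly R}).

Lemma tensorZ n (b c : {poly R}) (a : R) : tensor n b (a *: c) = a *: tensor n b c.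
Proof.
rewrite /tensor /lin scaler_sumr; apply: eq_bigr => i _.
by rewrite -scalerAl scalerA mulrC -scalerA.
Qed.

Lemma keep_lin P (g : nat -> {poly R}) p : keep P (lin g p) = lin (fun i => keep P (g i)) p.
Proof. exact: lin_lin. Qed.

(* The ranges of these maps are disjoint, being the level sets of the 2-adic valuation. *)
Definition dyadic k i := (2 ^ k * i.*2.+1)%N.

Lemma dyadic_increasing k : increasing (dyadic k).
Proof. by move=> i j ij; rewrite /dyadic ltn_pmul2l ?expn_gt0// ltnS ltn_double. Qed.

Lemma logn_dyadic k i : logn 2 (dyadic k i) = k.
Proof.
rewrite /dyadic lognM ?expn_gt0// pfactorK// [logn 2 _]lognE /= dvdn2 /= odd_double /=.
by rewrite addn0.
Qed.

Lemma keep_dyadic k l p :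
  keep (fun i => logn 2 i == k) (spread (dyadic l) p) = if l == k then spread (dyadic l) p else 0.
Proof.
rewrite /spread keep_lin; have [<-|lk] := eqVneq.
  by apply: eq_lin => i _; rewrite /keep linX logn_dyadic eqxx.
rewrite /lin big1// => i _; rewrite /keep linX logn_dyadic.
by rewrite (negPf lk) scaler0.
Qed.

Lemma spread_eq0 s p l :
  (forall i, p`_i != 0 -> s i != l) -> (spread s p)`_l = 0.
Proof.
move=> pl; rewrite coef_lin big1// => i _; rewrite coefXn.
have [->|/pl] := eqVneq p`_i 0; first by rewrite mul0r.
by rewrite eq_sym => /negPf ->; rewrite mulr0.
Qed.

(** The block [G j] superposes copies of the bad vectors [V k], [k <= j], with weights 2^-k on
    disjoint dyadic ranges. Its norm is bounded, so a subsequence is dominated by [e] after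
    normalization; projecting onto range [k] recovers the tensor product of [b k] and [V k] with
    weight 2^-k, which is too large since 4^k 2^-k is unbounded. *)
Lemma tensor_upper e : rosenthal_basis e ->
  exists2 D, 1 <= D & forall n (b c : {poly R}), (size c <= n)%N ->
    `|lin e (tensor n b c)| <= D * (`|lin e b| * `|lin e c|).
Proof.
move=> eR; have [eS e1 eb] := eR.
have eI : independent e by move=> p; apply: schauder_independent.
have [C1 C1_1 eC1] := rosenthal_subsymmetric e eR.
have [C2 C2_1 eC2] := rosenthal_unconditional e eR.
have C10 : 0 < C1 by exact: lt_le_trans C1_1.
have C20 : 0 < C2 by exact: lt_le_trans C2_1.
apply: contrapT => nD.
have bad (k : nat) : exists nbV : nat * {poly R} * {poly R},
    [/\ (0 < nbV.1.1)%N, (size nbV.2 <= nbV.1.1)%N, `|lin e nbV.2| = 1 &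
    4 ^+ k * `|lin e nbV.1.2| < `|lin e (tensor nbV.1.1 nbV.1.2 nbV.2)|].
  have [n [b [c [cn bad]]]] : exists n (b c : {poly R}), (size c <= n)%N /\
      4 ^+ k * (`|lin e b| * `|lin e c|) < `|lin e (tensor n b c)|.
    apply: contrapT => ngood; apply: nD; exists (4 ^+ k).
      by rewrite exprn_ege1// ler1n.
    move=> n b c cn; rewrite leNgt; apply/negP => ?; apply: ngood.
    by exists n, b, c.
  have c0 : c != 0.
    apply: contraTneq bad => ->; rewrite -(scale0r 0) tensorZ !linearZ !normrZ normr0 !mul0r.
    by rewrite !mulr0 ltxx.
  have Nc : 0 < `|lin e c| by rewrite normr_gt0; apply: contra_neqN c0 => /eqP/eI.
  exists (n, b, `|lin e c|^-1 *: c); split=> /=.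
  - by apply: leq_trans cn; rewrite size_poly_gt0.
  - exact: leq_trans (size_scale_leq _ _) cn.
  - by rewrite linearZ normrZ ger0_norm ?invr_ge0// mulVf// gt_eqF.
  - rewrite tensorZ linearZ normrZ ger0_norm ?invr_ge0// [ltRHS]mulrC.
    by rewrite ltr_pdivlMr// -mulrA.
have /choice[nbV nbVP] := bad.
pose n k := (nbV k).1.1; pose b k := (nbV k).1.2; pose V k := (nbV k).2.
pose M j := \sum_(k < j.+1) n k.
(* [M j] exceeds no index bound needed: it is at least the length of each [V k] with [k <= j]. As
   [t j.+1] is [dyadic j (M j + t j)], the support of [G j] lies strictly between [t j] and
   [t j.+1]. *)
pose t := fix t j := if j is i.+1 then (2 ^ i * (M i + t i).*2.+1)%N else 0%N.
have nM k j : (k <= j)%N -> (n k <= M j)%N.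
  by move=> kj; rewrite /M (bigD1 (Ordinal (kj : k < j.+1)%N)) //= leq_addr.
have tS j : (t j + M j <= t j.+1)%N.
  rewrite [t j.+1]/=; apply: (@leq_trans (1 * (M j + t j).*2.+1)).
    by rewrite mul1n; lia.
  by rewrite leq_mul2r expn_gt0 orbT.
have tle i j : (i <= j)%N -> (t i <= t j)%N.
  by apply: (homo_leq leqnn leq_trans) => k; apply: leq_trans (tS k); rewrite leq_addr.
pose H k j := spread (dyadic k) (V k * 'X^(t j)).
pose G j := \sum_(k < j.+1) 2^-1 ^+ k *: H k j.
have Gsupp j l : (G j)`_l != 0 -> (t j < l < t j.+1)%N.
  apply: contra_neqT => ljt; rewrite coef_sum big1// => k _; rewrite coefZ.
  rewrite spread_eq0 ?mulr0// => i; rewrite coefMXn; case: ltnP => ti; first by rewrite eqxx.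
  move=> Vi; apply: contraNneq ljt => <-.
  have it : (i < M j + t j)%N.
    rewrite addnC -ltn_subLR//; apply: leq_trans (nM k j _); last by rewrite -ltnS.
    have [_ + _ _] := nbVP k; apply: leq_trans; rewrite ltnNge.
    by apply: contra_neqN Vi => /(nth_default 0).
  apply/andP; split.
    rewrite /dyadic; apply: leq_trans (leq_pmull _ _); rewrite ?expn_gt0//; lia.
  rewrite /= /dyadic; apply: (@leq_ltn_trans (2 ^ j * i.*2.+1)).
    by rewrite leq_mul2r leq_exp2l// -ltnS ltn_ord orbT.
  by rewrite ltn_pmul2l ?expn_gt0// ltnS ltn_double.
have keepG k j : (k <= j)%N -> keep (fun i => logn 2 i == k) (G j) = 2^-1 ^+ k *: H k j.
  move=> kj; rewrite /G linear_sum /=.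
  rewrite (bigD1 (Ordinal (kj : k < j.+1)%N)) //= big1 ?addr0 => [|i ik].
    by rewrite linearZ /= keep_dyadic eqxx.
  by rewrite linearZ /= keep_dyadic (_ : (i == k :> nat) = false) ?scaler0//; apply/negbTE.
have NV k : `|lin e (V k)| = 1 by have [] := nbVP k.
have NH k j : `|lin e (H k j)| <= C1 ^+ 2 /\ 1 <= C1 ^+ 2 * `|lin e (H k j)|.
  have [h1 h2] := subsymmetric_spread _ _ (dyadic k) (V k * 'X^(t j)) eC1 (dyadic_increasing k).
  have [h3 h4] := subsymmetric_MXn _ _ (V k) (t j) eC1.
  rewrite NV mulr1 in h3; rewrite NV in h4; rewrite expr2; split.
    by apply: le_trans h1 _; rewrite ler_wpM2l ?(ltW C10).
  by apply: le_trans h4 _; rewrite -mulrA ler_wpM2l ?(ltW C10).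
pose mu j := `|lin e (G j)|.
have mu_le j : mu j <= 2 * C1 ^+ 2.
  have geo m : \sum_(k < m) 2^-1 ^+ k <= 2 :> R.
    suff -> : \sum_(k < m) 2^-1 ^+ k = 2 - 2 * 2^-1 ^+ m :> R.
      by rewrite gerBl mulr_ge0// exprn_ge0.
    elim: m => [|m IH]; first by rewrite big_ord0 expr0 mulr1 subrr.
    by rewrite big_ord_recr /= IH exprS; field.
  rewrite /mu /G linear_sum; apply: le_trans (ler_norm_sum _ _ _) _.
  apply: (@le_trans _ _ (\sum_(k < j.+1) 2^-1 ^+ k * C1 ^+ 2)).
    apply: ler_sum => k _; rewrite linearZ normrZ ger0_norm ?exprn_ge0//.
    by rewrite ler_wpM2l ?exprn_ge0//; exact: (NH k j).1.
  by rewrite -mulr_suml ler_wpM2r// sqr_ge0.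
(* The level 0 part of [G j] is a copy of [V 0], and unconditionality keeps it from exceeding a
   multiple of [mu j]. *)
have mu0 j : 0 < mu j.
  have := (NH 0%N j).2; have := eC2 (fun i => logn 2 i == 0%N) (G j).
  rewrite keepG// expr0 scale1r -/(mu j) => le1 le2.
  rewrite lt0r normr_ge0 andbT; apply: contraTneq le2 => mu0.
  by move: le1; rewrite mu0 mulr0 normr_le0 => /eqP ->; rewrite normr0 mulr0 ler10.
pose y j := lin e ((mu j)^-1 *: G j).
have yb : bb e y.
  apply: bb_lin => [j|i j ij].
    by rewrite linearZ normrZ ger0_norm ?invr_ge0 ?(ltW (mu0 _))// mulVf// gt_eqF.
  move=> k l; rewrite !coefZ !mulf_eq0 !negb_or.
  move=> /andP[_ /Gsupp/andP[_ k1]] /andP[_ /Gsupp/andP[l1 _]].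
  by apply: leq_ltn_trans l1; apply: leq_trans (ltnW k1) _; exact: tle.
have [s si /dom_equivalent[C0 [C0_1 ye ey]]] := eb y yb.
have C00 : 0 < C0 by exact: lt_le_trans C0_1.
pose E := C1 * C1 * C2 * (C0 * (C1 * ((2 * C2 + 1) * (2 * C1 ^+ 2)))).
have E0 : 0 < E by rewrite !mulr_gt0// ?addr_gt0// ?mulr_gt0// exprn_gt0.
have main k : 2 ^+ k < E.
  (* Level [k] occurs only in the blocks [G j] with [k <= j], hence the shift by [k]. *)
  pose sk i := s (i + k)%N.
  have ski i : (k <= sk i)%N by apply: leq_trans (increasing_ge _ si _); rewrite leq_addl.
  pose p := \poly_(i < size (b k)) ((b k)`_i * mu (sk i)).
  have lp : lin (y \o s) (p * 'X^k) = lin e (lin (G \o sk) (b k)).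
    rewrite lin_MXn /p -(linZ _ (mu \o sk)) lin_lin; apply: eq_lin => i _ /=.
    by rewrite /y linearZ /= scalerA mulfV ?scale1r// gt_eqF.
  have up : `|lin e (lin (G \o sk) (b k))| <=
      C0 * (C1 * ((2 * C2 + 1) * (2 * C1 ^+ 2))) * `|lin e (b k)|.
    rewrite -lp; apply: le_trans (ey _) _; rewrite -[leRHS]mulrA ler_wpM2l ?(ltW C00)//.
    apply: le_trans (subsymmetric_MXn _ _ p k eC1).1 _.
    rewrite -[leRHS]mulrA ler_wpM2l ?(ltW C10)// -[leRHS]mulrA.
    have -> : 2 * C1 ^+ 2 * `|lin e (b k)| = `|lin e ((2 * C1 ^+ 2) *: b k)|.
      by rewrite linearZ normrZ ger0_norm// mulr_ge0// sqr_ge0.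
    apply: unconditional_le => // i.
    rewrite (coef_poly_mul (mu \o sk)) coefZ mulrC !normrM ler_wpM2r//.
    rewrite ger0_norm ?(ltW (mu0 _))//; apply: le_trans (mu_le _) _.
    by rewrite -!normrM; exact: ler_norm.
  have low : 2^-1 ^+ k * `|lin e (tensor (n k) (b k) (V k))| <=
      C1 * C1 * C2 * `|lin e (lin (G \o sk) (b k))|.
    have := eC2 (fun i => logn 2 i == k) (lin (G \o sk) (b k)).
    have -> : keep (fun i => logn 2 i == k) (lin (G \o sk) (b k)) =
        2^-1 ^+ k *: spread (dyadic k) (lin (fun i => V k * 'X^(t (sk i))) (b k)).
      rewrite keep_lin /spread lin_lin /lin scaler_sumr; apply: eq_bigr => i _.
      by rewrite keepG// scalerA mulrC -scalerA.
    rewrite linearZ normrZ ger0_norm ?exprn_ge0// => le1.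
    have [n0 Vn _ _] := nbVP k.
    have un j : (t (sk j) + n k <= t (sk j.+1))%N.
      apply: (@leq_trans (t (sk j).+1)); last by apply/tle/si.
      by apply: leq_trans (tS _); rewrite leq_add2l nM.
    have [_ h1] := subsymmetric_tensor _ _ _ _ (b k) _ eC1 Vn n0 un.
    have [_ h2] := subsymmetric_spread _ _ (dyadic k)
      (lin (fun i => V k * 'X^(t (sk i))) (b k)) eC1 (dyadic_increasing k).
    rewrite -!mulrA; apply: le_trans (ler_wpM2l (ltW C10) (ler_wpM2l (ltW C10) le1)).
    rewrite [C1 * (2^-1 ^+ k * _)]mulrCA [C1 * (2^-1 ^+ k * _)]mulrCA ler_wpM2l ?exprn_ge0//.
    by apply: le_trans h1 _; rewrite ler_wpM2l ?(ltW C10).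
  have [_ _ _ big] := nbVP k.
  have : 2 ^+ k * `|lin e (b k)| < E * `|lin e (b k)|.
    apply: lt_le_trans (_ : 2^-1 ^+ k * `|lin e (tensor (n k) (b k) (V k))| <= _).
      rewrite -(ltr_pM2l (_ : 0 < 2 ^+ k)) ?exprn_gt0// !mulrA -!exprMn.
      by rewrite mulfV// expr1n mul1r (_ : 2 * 2 = 4 :> R)// -natrM.
    apply: le_trans low _; rewrite /E -!mulrA !ler_wpM2l ?(ltW C10) ?(ltW C20)//.
    by apply: le_trans up _; rewrite -!mulrA.
  have [b0|b0] := eqVneq `|lin e (b k)| 0; first by rewrite b0 !mulr0 ltxx.
  by rewrite ltr_pM2r// lt_neqAle eq_sym b0 normr_ge0.
have := main (Num.truncn E).+1; apply/negP; rewrite -leNgt.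
apply: le_trans (ltW (truncnS_gt E)) _.
by rewrite -natrX ler_nat ltnW// ltn_expl.
Qed.

End TensorUpper.

(** * Quasi-multiplicative sequences *)

Section PowerLaw.
Context {R : realType}.

(** A Fekete argument: for positive j and k, comparing both with u(jk) gives (u(j) - d)/j <= (u(k) +
    d)/k, and the supremum of the left sides serves as slope. The index 0 is covered by |u(0)| <=
    d. *)
Lemma quasi_additive (u : nat -> R) (d : R) :
  (forall j k, `|u (j + k)%N - u j - u k| <= d) ->
  exists b, forall k, `|u k - k%:R * b| <= d.
Proof.
move=> ud.
have d0 : 0 <= d by exact: le_trans (ud 0%N 0%N).
have up j k : u (j.+1 * k)%N + d <= j.+1%:R * (u k + d).
  elim: j => [|j IH]; first by rewrite !mul1n mul1r.
  have := ud k (j.+1 * k)%N; rewrite -mulSn ler_norml -[j.+2%:R]natr1 mulrDl mul1r.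
  by move=> /andP[_ ?]; lra.
have low j k : j.+1%:R * (u k - d) <= u (j.+1 * k)%N - d.
  elim: j => [|j IH]; first by rewrite !mul1n mul1r.
  have := ud k (j.+1 * k)%N; rewrite -mulSn ler_norml -[j.+2%:R]natr1 mulrDl mul1r.
  by move=> /andP[? _]; lra.
have cross j k : (u j.+1 - d) / j.+1%:R <= (u k.+1 + d) / k.+1%:R.
  rewrite ler_pdivrMr ?ltr0n// mulrAC ler_pdivlMr ?ltr0n// mulrC [leRHS]mulrC.
  apply: le_trans (low k j.+1) _; apply: le_trans (up j k.+1).
  by rewrite mulnC; lra.
pose E := range (fun j => (u j.+1 - d) / j.+1%:R).
have Eub k : ubound E ((u k.+1 + d) / k.+1%:R) by move=> _ [j _ <-].
exists (sup E) => -[|k].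
  rewrite mul0r subr0; have := ud 0%N 0%N.
  by rewrite addn0 subrr add0r normrN.
have k0 : 0 < k.+1%:R :> R by rewrite ltr0n.
rewrite ler_norml lerNl opprB !lerBlDr; apply/andP; split.
  rewrite addrC mulrC -ler_pdivlMr//; apply: ge_sup => //.
  by exists ((u 1%N - d) / 1%:R); exists 0%N.
rewrite -lerBlDl mulrC -ler_pdivrMr//.
by apply: ub_le_sup; [exists ((u 1%N + d) / 1%:R); exact: Eub|exists k].
Qed.

(** On powers of 2 the logarithm of [l] is quasi-additive, hence linear up to a constant;
    quasi-monotonicity fills the gaps between consecutive powers. The lower bound 1/L forces
    [0 <= a], and the bound by [n] forces [a <= 1]. *)
Lemma quasi_multiplicative_power (l : nat -> R) (L D : R) : 1 <= D ->
  l 1%N = 1 ->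
  (forall m n, (m <= n)%N -> l m <= L * l n) ->
  (forall m n, l m * l n <= D * l (m * n)%N) ->
  (forall m n, l (m * n)%N <= D * (l m * l n)) ->
  (forall n, l n <= n%:R) ->
  exists a, [/\ 0 <= a, a <= 1 & exists2 M, 1 <= M &
    forall n, (0 < n)%N -> l n <= M * n%:R `^ a /\ n%:R `^ a <= M * l n].
Proof.
move=> D1 l1 lmon lsup lsub ln_le.
have D0 : 0 < D by exact: lt_le_trans D1.
have L1 : 1 <= L by have := lmon 1%N 1%N (leqnn _); rewrite l1 mulr1.
have L0 : 0 < L by exact: lt_le_trans L1.
have l0 n : (0 < n)%N -> 0 < l n.
  by move=> /(lmon 1%N n); rewrite l1 -(pmulr_rgt0 (l n) L0); apply: lt_le_trans.
pose v k := l (2 ^ k)%N.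
have v0 k : 0 < v k by apply: l0; rewrite expn_gt0.
have [b bP] : exists b, forall k, `|ln (v k) - k%:R * b| <= ln D.
  apply: quasi_additive => j k; rewrite /v expnD.
  have : ln (l (2 ^ j)%N) + ln (l (2 ^ k)%N) <= ln D + ln (l (2 ^ j * 2 ^ k)%N).
    by rewrite -!lnM ?posrE ?mulr_gt0 ?l0 ?muln_gt0 ?expn_gt0//
      ler_ln ?posrE ?mulr_gt0 ?l0 ?muln_gt0 ?expn_gt0.
  have : ln (l (2 ^ j * 2 ^ k)%N) <= ln D + (ln (l (2 ^ j)%N) + ln (l (2 ^ k)%N)).
    by rewrite -!lnM ?posrE ?mulr_gt0 ?l0 ?expn_gt0//
      ler_ln ?posrE ?mulr_gt0 ?l0 ?muln_gt0 ?expn_gt0.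
  by rewrite ler_norml => ? ?; apply/andP; split; lra.
have arch (x y : R) : (forall k, k%:R * x <= y) -> x <= 0.
  move=> xy; rewrite leNgt; apply/negP => x0.
  have := xy (Num.truncn (y / x)).+1; apply/negP; rewrite -ltNge -ltr_pdivrMr//.
  exact: truncnS_gt.
have b0 : 0 <= b.
  rewrite -oppr_le0; apply: (arch _ (ln L + ln D)) => k.
  have := bP k; rewrite ler_norml => /andP[_ ?].
  suff : 0 <= ln L + ln (v k) by rewrite mulrN; lra.
  rewrite -lnM ?posrE// ln_ge0// -l1; apply: lmon; exact: expn_gt0.
have ln2 : 0 < ln 2 :> R by rewrite ln_gt0// ltr1n.
have b_le : b <= ln 2.
  rewrite -subr_le0; apply: (arch _ (ln D)) => k.
  have := bP k; rewrite ler_norml => /andP[? _].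
  suff : ln (v k) <= k%:R * ln 2 by rewrite mulrBr; lra.
  rewrite mulr_natl -lnXn// ler_ln ?posrE ?exprn_gt0//; by rewrite -natrX; exact: ln_le.
have vle k : v k <= D * expR (k%:R * b).
  have := bP k; rewrite ler_norml => /andP[_ ?].
  by rewrite -{1}(lnK D0) -expRD -[leLHS](lnK (v0 k)) ler_expR; lra.
have vge k : expR (k%:R * b) <= D * v k.
  have := bP k; rewrite ler_norml => /andP[? _].
  by rewrite -{1}(lnK D0) -[v k](lnK (v0 k)) -expRD ler_expR; lra.
have eb : expR b <= 2 by rewrite -[leRHS](@lnK R) ?posrE// ler_expR.
have eS k : expR (k.+1%:R * b) <= 2 * expR (k%:R * b).
  by rewrite -natr1 mulrDl mul1r addrC expRD ler_wpM2r// expR_ge0.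
pose a := b / ln 2.
have a0 : 0 <= a by rewrite divr_ge0// ltW.
have pow2 k : (2 ^ k)%:R `^ a = expR (k%:R * b).
  rewrite -[LHS]lnK ?posrE ?powR_gt0 ?ltr0n ?expn_gt0// ln_powR natrX lnXn//.
  by rewrite /a -[ln 2 *+ k]mulr_natl mulrCA divfK// gt_eqF.
exists a; split=> //; first by rewrite ler_pdivrMr// mul1r.
(* [D] is lost on powers of 2, [L] in passing from [n] to a power of 2, and 2 bounds the ratio of
   consecutive values of the power law. *)
exists (2 * L * D); first by rewrite mulr_ege1// mulr_ege1// ler1n.
move=> n n0; pose k := trunc_log 2 n.
have kn : (2 ^ k <= n)%N by rewrite trunc_logP.
have nk : (n <= 2 ^ k.+1)%N by rewrite ltnW// trunc_log_ltn.
have p1 : expR (k%:R * b) <= n%:R `^ a.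
  by rewrite -pow2 ge0_ler_powR ?nnegrE// ler_nat.
have p2 : n%:R `^ a <= 2 * expR (k%:R * b).
  apply: le_trans (eS k); rewrite -pow2 ge0_ler_powR ?nnegrE// ler_nat//.
split.
  apply: le_trans (lmon _ _ nk) _.
  rewrite (_ : 2 * L * D * _ = L * (D * (2 * n%:R `^ a))); last by ring.
  rewrite ler_wpM2l ?(ltW L0)//.
  apply: le_trans (vle _) _; rewrite ler_wpM2l ?(ltW D0)//; apply: le_trans (eS _) _.
  by rewrite ler_wpM2l.
apply: le_trans p2 _; rewrite (_ : 2 * L * D * _ = 2 * (D * (L * l n))); last by ring.
rewrite ler_wpM2l//; apply: le_trans (vge _) _.
by rewrite ler_wpM2l ?(ltW D0)//; exact: lmon.
Qed.

(** If y < x, the even powers of x/y grow at least quadratically, by Bernoulli's inequality used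
    twice, and outrun the linear factor. *)
Lemma pow_le_linear (x y M B : R) : 0 <= x -> 0 <= y -> 0 <= B ->
  (forall k, x ^+ k <= M * (1 + k%:R * B) * y ^+ k) -> x <= y.
Proof.
move=> x0 y0 B0 xy; rewrite leNgt; apply/negP => yx.
have {}x0 : 0 < x by exact: le_lt_trans yx.
have M0 : 0 < M by have := xy 0%N; rewrite !expr0 mul0r addr0 !mulr1; exact: lt_le_trans.
have {}y0 : 0 < y.
  rewrite lt0r y0 andbT; apply/eqP => ye; have := xy 1%N.
  by rewrite ye expr1 expr0n mulr0 leNgt x0.
pose d := x / y - 1.
have d0 : 0 < d by rewrite subr_gt0 ltr_pdivlMr// mul1r.
have bern k : k%:R * d <= (x / y) ^+ k.
  rewrite -[x / y](subrK 1) -/d; suff : 1 + k%:R * d <= (d + 1) ^+ k by lra.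
  elim: k => [|k IH]; first by rewrite expr0 mul0r addr0.
  rewrite exprS; apply: (@le_trans _ _ ((d + 1) * (1 + k%:R * d))); last first.
    by rewrite ler_wpM2l// addr_ge0// ltW.
  rewrite -natr1; have : 0 <= k%:R * d * d by rewrite !mulr_ge0// ltW.
  lra.
(* With k d^2 > M (1 + 2B), the exponent 2k gives (kd)^2 > k M (1 + 2B) >= M (1 + 2kB). *)
pose k := (Num.truncn (M * (1 + 2 * B) / d ^+ 2)).+1.
have k0 : 0 < k%:R :> R by rewrite ltr0n.
have kbig : M * (1 + 2 * B) < k%:R * d ^+ 2.
  by rewrite -ltr_pdivrMr ?exprn_gt0//; exact: truncnS_gt.
have := xy (k + k)%N; rewrite -ler_pdivrMr ?exprn_gt0// -expr_div_n exprD.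
apply/negP; rewrite -ltNge.
apply: (@lt_le_trans _ _ ((k%:R * d) * (k%:R * d))); last first.
  by rewrite ler_pM// mulr_ge0// ltW.
apply: (@le_lt_trans _ _ (k%:R * (M * (1 + 2 * B)))).
  rewrite mulrCA ler_wpM2l ?(ltW M0)// natrD.
  have : 1 <= k%:R :> R by rewrite ler1n.
  lra.
rewrite -!mulrA ltr_pM2l// [X in _ < X]mulrCA.
by move: kbig; rewrite expr2 mulrA [_ * d]mulrC mulrA.
Qed.

End PowerLaw.

(** * Power sums *)

Definition ones {R : realType} n : {poly R} := \poly_(i < n) 1.

Definition sum_powR {R : realType} (r : R) (a : {poly R}) : R :=
  \sum_(i < size a) `|a`_i| `^ r.

Section Powers.
Context {R : realType}.
Implicit Types (a b c : {poly R}) (r : R).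

Lemma coef_tensor n b c l : (size c <= n)%N -> (0 < n)%N ->
  (tensor n b c)`_l = b`_(l %/ n) * c`_(l %% n).
Proof.
move=> cn n0; rewrite /tensor coef_lin.
have term j : (c * 'X^(j * n))`_l = if j == (l %/ n)%N then c`_(l %% n) else 0.
  rewrite coefMXn {1 2}(divn_eq l n); have lt := ltn_pmod l n0.
  have [jl|jl|->] := ltngtP j (l %/ n).
  - case: ifP => // _; apply: nth_default; apply: leq_trans cn _.
    have : (j.+1 * n <= l %/ n * n)%N by rewrite leq_mul2r jl orbT.
    by rewrite mulSn; lia.
  - rewrite ifT//; have : ((l %/ n).+1 * n <= j * n)%N by rewrite leq_mul2r jl orbT.
    by rewrite mulSn; lia.
  - by rewrite ltnNge leq_addr /= addKn.
have [lb|lb] := ltnP (l %/ n) (size b).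
  rewrite (bigD1 (Ordinal lb)) //= term eqxx big1 ?addr0// => j jl.
  by rewrite term ifN ?mulr0//.
rewrite [b`_(l %/ n)]nth_default// mul0r big1// => j _.
by rewrite term ltn_eqF ?mulr0//; exact: leq_trans lb.
Qed.

Lemma size_tensor n b c : (size c <= n)%N -> (0 < n)%N -> (size (tensor n b c) <= size b * n)%N.
Proof.
move=> cn n0; apply/leq_sizeP => j bj; rewrite coef_tensor//.
by rewrite nth_default ?mul0r// leq_divRL.
Qed.

Lemma tensor_ones m n : (0 < n)%N ->
  tensor n (ones m) (ones n) = ones (m * n) :> {poly R}.
Proof.
move=> n0; apply/polyP => l; rewrite coef_tensor ?size_poly// !coef_poly.
by rewrite ltn_pmod// mulr1 ltn_divLR.
Qed.

(** Zero to the power zero is 1, so padding with zero coefficients leaves the sum unchanged because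
    [r] is nonzero. *)
Lemma sum_powR_widen r a n : r != 0 -> (size a <= n)%N ->
  sum_powR r a = \sum_(i < n) `|a`_i| `^ r.
Proof.
move=> r0 an; rewrite /sum_powR (big_ord_widen n (fun i => `|a`_i| `^ r) an).
rewrite [RHS](bigID (fun i : 'I_n => i < size a)%N) /= [X in _ = _ + X]big1 ?addr0//.
by move=> i; rewrite -leqNgt => ai; rewrite nth_default// normr0 powR0.
Qed.

Lemma sum_powR_ge0 r a : 0 <= sum_powR r a.
Proof. by apply: sumr_ge0 => i _; exact: powR_ge0. Qed.

Lemma sum_powR_tensor r n b c : r != 0 -> (size c <= n)%N -> (0 < n)%N ->
  sum_powR r (tensor n b c) = sum_powR r b * sum_powR r c.
Proof.
move=> r0 cn n0; rewrite (sum_powR_widen _ _ _ r0 (size_tensor _ _ _ cn n0)).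
rewrite (sum_powR_widen _ c n r0 cn) /sum_powR mulr_suml.
rewrite -(big_mkord xpredT (fun i => `|(tensor n b c)`_i| `^ r)) big_nat_mul big_mkord.
apply: eq_bigr => j _; rewrite mulr_sumr -{1}[(j * n)%N]add0n mulSn big_addn addnK big_mkord.
apply: eq_bigr => i _; rewrite coef_tensor// addnC divnMDl// modnMDl divn_small// modn_small//.
by rewrite addn0 normrM powRM.
Qed.

Lemma sum_powRZ r a k : 0 < r -> sum_powR r (k *: a) = `|k| `^ r * sum_powR r a.
Proof.
move=> r0; rewrite (sum_powR_widen _ _ (size a)) ?gt_eqF ?size_scale_leq// mulr_sumr.
by apply: eq_bigr => i _; rewrite coefZ normrM powRM.
Qed.

Lemma sum_powR_le r a b : 0 < r -> (forall i, `|a`_i| <= `|b`_i|) ->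
  sum_powR r a <= sum_powR r b.
Proof.
move=> r0 ab; pose n := maxn (size a) (size b).
rewrite (sum_powR_widen r a n) ?gt_eqF ?leq_maxl// (sum_powR_widen r b n) ?gt_eqF ?leq_maxr//.
by apply: ler_sum => i _; rewrite ge0_ler_powR ?nnegrE// ltW.
Qed.

(** For a subsymmetric basis this makes the norm of a 0-1 sequence depend, up to a constant, only on
    the number of ones. *)
Lemma indicator_spread (P : pred nat) n : exists2 s, increasing s &
  \poly_(i < n) (P i)%:R = spread s (ones (\sum_(i < n) P i)) :> {poly R}.
Proof.
suff [s [si sn ->]] : exists s, [/\ increasing s,
    forall i, (i < \sum_(i < n) P i)%N -> (s i < n)%N &
    \poly_(i < n) (P i)%:R = spread s (ones (\sum_(i < n) P i)) :> {poly R}] by exists s.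
have onesS m : ones m.+1 = ones m + 'X^m :> {poly R}.
  by rewrite /ones !poly_def big_ord_recr /= scale1r.
have polyS m : \poly_(i < m.+1) (P i)%:R = \poly_(i < m) (P i)%:R + (P m)%:R *: 'X^m :> {poly R}.
  by rewrite !poly_def big_ord_recr.
elim: n => [|n [s [si sn IH]]].
  exists id; split=> //; first by move=> i; rewrite big_ord0.
  rewrite big_ord0 (_ : ones 0 = 0) ?linear0; first by rewrite poly_def big_ord0.
  by rewrite /ones poly_def big_ord0.
set m := (\sum_(i < n) P i)%N in sn IH *.
rewrite polyS big_ord_recr /= -/m; case: (P n); last first.
  rewrite scale0r !addr0 addn0; exists s; split=> // i /sn /ltnW.
  by rewrite ltnS.
(* Index [m] goes to the new point [n]; the later values only keep the map increasing. *)
exists (fun i => if (i < m)%N then s i else (n + (i - m))%N); split.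
- move=> i j ij; case: (ltnP i m) => im; case: (ltnP j m) => jm.
  + exact: si.
  + by have := sn _ im; lia.
  + by lia.
  + by lia.
- move=> i; rewrite addn1 ltnS; case: (ltnP i m) => [/sn|mi im]; first by lia.
  by lia.
rewrite addn1 onesS linearD /= /spread linX ltnn subnn addn0 scale1r; congr (_ + _).
rewrite IH; apply: eq_lin => i im; rewrite ifT//.
by apply: leq_trans im (size_poly _ _).
Qed.

End Powers.

(** * The tensor power argument *)

Section PowerNorm.
Context {R : realType} {X : completeNormedModType R}.
Implicit Types (e x : nat -> X) (a b c p q : {poly R}).

(** [a] splits into [B] multiples of indicators, whose norms are known. The triangle inequality
    gives the upper bound; the lower one holds because each piece is dominated by [a]
    coordinatewise. *)
Lemma level_bounds e (C L M r : R) :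
  subsymmetric C e -> 1 <= C -> 1 <= L -> 1 <= M -> 1 <= r ->
  (forall p q, (forall i, `|p`_i| <= `|q`_i|) -> `|lin e p| <= L * `|lin e q|) ->
  (forall n, (0 < n)%N -> `|lin e (ones n)| <= M * n%:R `^ r^-1 /\
                          n%:R `^ r^-1 <= M * `|lin e (ones n)|) ->
  forall B a, (forall i, a`_i = 0 \/ exists2 t, (t < B)%N & a`_i = 2^-1 ^+ t) ->
    `|lin e a| <= C * M * L * B%:R * sum_powR r a `^ r^-1 /\
    sum_powR r a `^ r^-1 <= C * M * L * B%:R * `|lin e a|.
Proof.
move=> eC C1 L1 M1 r1 eU lam B a aB.
have r0 : 0 < r by exact: lt_le_trans r1.
have C0 : 0 < C by exact: lt_le_trans C1.
have L0 : 0 < L by exact: lt_le_trans L1.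
have M0 : 0 < M by exact: lt_le_trans M1.
have half0 t : 0 <= 2^-1 ^+ t :> R by rewrite exprn_ge0.
have half_gt0 t : 0 < 2^-1 ^+ t :> R by rewrite exprn_gt0// invr_gt0.
pose P t i := a`_i == 2^-1 ^+ t.
pose I t : {poly R} := \poly_(i < size a) (P t i)%:R.
pose h t := (\sum_(i < size a) P t i)%N.
have levelE (F : R -> R) i : F 0 = 0 -> F a`_i = \sum_(t < B) (P t i)%:R * F (2^-1 ^+ t).
  move=> F0; rewrite /P; case: (aB i) => [->|[t tB ->]].
    by rewrite F0 big1// => t _; rewrite eq_sym gt_eqF ?mul0r.
  rewrite (bigD1 (Ordinal tB)) //= eqxx mul1r big1 ?addr0// => s st.
  rewrite (_ : _ == _ = false) ?mul0r//; apply: contraNF st => /eqP.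
  by move=> /ieexprIn st; rewrite -val_eqE /= st// ?invr_gt0// lt_eqF// invf_lt1// ltr1n.
have aE : a = \sum_(t < B) 2^-1 ^+ t *: I t.
  apply/polyP => i; rewrite (levelE id)// coef_sum; apply: eq_bigr => t _.
  rewrite coefZ coef_poly mulrC; case: ltnP => // ai.
  by rewrite /P nth_default// eq_sym gt_eqF.
have SE : sum_powR r a = \sum_(t < B) (2^-1 ^+ t) `^ r * (h t)%:R.
  rewrite /sum_powR; under eq_bigr => i _.
    rewrite (levelE (fun x : R => `|x| `^ r)); last by rewrite normr0 powR0// gt_eqF.
    over.
  rewrite exchange_big /=; apply: eq_bigr => t _.
  by rewrite -mulr_suml mulrC natr_sum ger0_norm.
have lamI t : `|lin e (I t)| <= C * M * (h t)%:R `^ r^-1 /\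
              (h t)%:R `^ r^-1 <= C * M * `|lin e (I t)|.
  have [s si IE] := @indicator_spread R (P t) (size a).
  have [I1 I2] := subsymmetric_spread C e s (ones (h t)) eC si.
  rewrite /I IE -/(h t); have [h0|h0] := posnP (h t).
    rewrite h0 (_ : ones 0 = 0); last by rewrite /ones poly_def big_ord0.
    by rewrite !linear0 normr0 powR0 ?mulr0// gt_eqF// invr_gt0.
  have [l1 l2] := lam _ h0; rewrite -!mulrA; split.
    by apply: le_trans I1 _; rewrite ler_wpM2l// ltW.
  rewrite mulrCA; apply: le_trans l2 _; rewrite ler_wpM2l//; exact: ltW.
have termE t : 2^-1 ^+ t * (h t)%:R `^ r^-1 = ((2^-1 ^+ t) `^ r * (h t)%:R) `^ r^-1.
  by rewrite powRM ?powR_ge0// -powRrM mulfV ?gt_eqF// powRr1.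
have term0 t : 0 <= (2^-1 ^+ t) `^ r * (h t)%:R by rewrite mulr_ge0// powR_ge0.
have ri0 : 0 <= r^-1 by rewrite invr_ge0 ltW.
split.
  rewrite {1}aE linear_sum; apply: le_trans (ler_norm_sum _ _ _) _.
  apply: (@le_trans _ _ (\sum_(t < B) C * M * L * sum_powR r a `^ r^-1)); last first.
    by rewrite sumr_const card_ord -[_ *+ B]mulr_natr [leRHS]mulrAC.
  apply: ler_sum => t _; rewrite linearZ normrZ (ger0_norm (half0 t)).
  apply: le_trans (ler_wpM2l (half0 t) (lamI t).1) _.
  rewrite mulrCA -[C * M * L]mulrA [M * L]mulrC mulrA -!mulrA ler_wpM2l ?(ltW C0)//.
  apply: (@le_trans _ _ (M * sum_powR r a `^ r^-1)).
    rewrite ler_wpM2l ?(ltW M0)// termE ge0_ler_powR ?nnegrE ?sum_powR_ge0//.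
    by rewrite SE (bigD1 t) //= lerDl sumr_ge0.
  by rewrite ler_peMl// mulr_ge0 ?powR_ge0// ltW.
(* [Y] bounds the l_r norm of every level, so the power sum is at most B Y^r; since [1 <= r], the
   r-th root of [B] is at most [B]. *)
pose Y := C * M * L * `|lin e a|.
have Y0 : 0 <= Y by rewrite !mulr_ge0// ltW.
have SY : sum_powR r a <= B%:R * Y `^ r.
  rewrite SE (_ : B%:R * Y `^ r = \sum_(t < B) Y `^ r); last first.
    by rewrite sumr_const card_ord mulr_natl.
  apply: ler_sum => t _.
  have -> : (2^-1 ^+ t) `^ r * (h t)%:R = (2^-1 ^+ t * (h t)%:R `^ r^-1) `^ r.
    by rewrite termE -powRrM mulVf ?gt_eqF// powRr1.
  have u0 : 0 <= 2^-1 ^+ t * (h t)%:R `^ r^-1 by rewrite mulr_ge0// powR_ge0.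
  apply: ge0_ler_powR; rewrite ?nnegrE ?(ltW r0)//.
  apply: le_trans (ler_wpM2l (half0 t) (lamI t).2) _.
  rewrite mulrCA /Y -mulrA ler_wpM2l ?mulr_ge0 ?(ltW C0) ?(ltW M0)//.
  have -> : 2^-1 ^+ t * `|lin e (I t)| = `|lin e (2^-1 ^+ t *: I t)|.
    by rewrite linearZ normrZ ger0_norm.
  apply: eU => i; rewrite coefZ coef_poly; case: ltnP => _; last by rewrite mulr0 normr0.
  by rewrite /P; case: eqP => [->|_]; rewrite ?mulr1// mulr0 normr0.
apply: le_trans (ge0_ler_powR ri0 _ _ SY) _.
- by rewrite nnegrE sum_powR_ge0.
- by rewrite nnegrE mulr_ge0// powR_ge0.
rewrite powRM ?powR_ge0// -powRrM mulfV ?gt_eqF// powRr1//.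
rewrite (_ : C * M * L * B%:R * _ = B%:R * Y); last by rewrite /Y; ring.
rewrite ler_wpM2r//.
have [->|B0] := posnP B; first by rewrite powR0// gt_eqF// invr_gt0.
by rewrite ler1_powR ?ler1n// invf_le1.
Qed.

End PowerNorm.

(** * Removal of the level-count factor, and rounding of general coefficients *)

Section TensorPower.
Context {R : realType} {X : completeNormedModType R}.
Implicit Types (e x : nat -> X) (a b c p q : {poly R}).

Lemma dyadic_rounding (u : R) : 0 < u -> u <= 1 ->
  exists t, u <= 2^-1 ^+ t /\ 2^-1 ^+ t <= 2 * u.
Proof.
move=> u0 u1.
have ex : exists t, 2^-1 ^+ t < u.
  exists (Num.truncn u^-1).+1; rewrite exprVn -[ltRHS]invrK ltf_pV2 ?posrE ?exprn_gt0 ?invr_gt0//.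
  apply: lt_trans (truncnS_gt _) _.
  by rewrite -natrX ltr_nat ltn_expl.
case: (ex_minnP ex) => -[|t] tu tmin; first by rewrite expr0 ltNge u1 in tu.
exists t; split; first by rewrite leNgt; apply/negP => /tmin; rewrite ltnn.
by move: tu; rewrite exprS mulrC ltr_pdivrMr// mulrC => /ltW.
Qed.

(** Under k-th tensor powers both sides become k-th powers up to D^k, while the number of levels
    grows only linearly in k; [pow_le_linear] absorbs [K] and the level count. *)
Lemma tensor_power_bounds e (D K r : R) :
  (forall i, `|e i| = 1) -> 1 <= D -> 0 <= K -> 0 < r ->
  (forall n b c, (size c <= n)%N -> `|lin e b| * `|lin e c| <= D * `|lin e (tensor n b c)|) ->
  (forall n b c, (size c <= n)%N -> `|lin e (tensor n b c)| <= D * (`|lin e b| * `|lin e c|)) ->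
  (forall B a, (forall i, a`_i = 0 \/ exists2 t, (t < B)%N & a`_i = 2^-1 ^+ t) ->
    `|lin e a| <= K * B%:R * sum_powR r a `^ r^-1 /\
    sum_powR r a `^ r^-1 <= K * B%:R * `|lin e a|) ->
  forall B a, (forall i, a`_i = 0 \/ exists2 t, (t < B)%N & a`_i = 2^-1 ^+ t) ->
    `|lin e a| <= D * sum_powR r a `^ r^-1 /\ sum_powR r a `^ r^-1 <= D * `|lin e a|.
Proof.
move=> e1 D1 K0 r0 low up lev B a aB.
have D0 : 0 < D by exact: lt_le_trans D1.
have [->|a0] := eqVneq a 0.
  rewrite linear0 normr0 /sum_powR size_poly0 big_ord0 powR0 ?mulr0//.
  by rewrite gt_eqF// invr_gt0.
pose n := size a; have n0 : (0 < n)%N by rewrite size_poly_gt0.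
pose T k : {poly R} := iter k (fun b => tensor n b a) 1.
have TS k : T k.+1 = tensor n (T k) a by [].
(* Exponents add up under products; the successor makes room for exponent 0 in [T 0], which is the
   constant 1. *)
have Tlev k i : (T k)`_i = 0 \/ exists2 t, (t < (k * B).+1)%N & (T k)`_i = 2^-1 ^+ t.
  elim: k i => [|k IH] i.
    by rewrite coef1; case: eqP => _; [right; exists 0%N|left].
  rewrite TS coef_tensor//; case: (IH (i %/ n)%N) => [->|[t tk ->]]; first by left; rewrite mul0r.
  case: (aB (i %% n)%N) => [->|[s sB ->]]; first by left; rewrite mulr0.
  by right; exists (t + s)%N; [lia|rewrite exprD].
have TSum k : sum_powR r (T k) = sum_powR r a ^+ k.
  elim: k => [|k IH].
    by rewrite /sum_powR /T /= size_poly1 big_ord1 coef1 normr1 powR1 expr0.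
  by rewrite TS sum_powR_tensor ?gt_eqF// IH exprSr.
have powX k : sum_powR r (T k) `^ r^-1 = (sum_powR r a `^ r^-1) ^+ k.
  rewrite TSum -!powR_mulrn ?powR_ge0 ?sum_powR_ge0//.
  by rewrite powRAC.
have T1 : `|lin e (T 0%N)| = 1 by rewrite /T /= -(expr0 'X) linX.
have lowk k : `|lin e a| ^+ k <= D ^+ k * `|lin e (T k)|.
  elim: k => [|k IH]; first by rewrite !expr0 mul1r T1.
  rewrite exprSr; apply: le_trans (ler_wpM2r (normr_ge0 _) IH) _.
  rewrite -mulrA exprSr -[leRHS]mulrA ler_wpM2l ?exprn_ge0 ?(ltW D0)//.
  exact: low.
have upk k : `|lin e (T k)| <= D ^+ k * `|lin e a| ^+ k.
  elim: k => [|k IH]; first by rewrite !expr0 mul1r T1.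
  apply: le_trans (up _ _ _ (leqnn _)) _; rewrite [D ^+ k.+1]exprS -mulrA.
  rewrite ler_wpM2l ?(ltW D0)// exprSr mulrA; exact: ler_wpM2r.
have natE k : (k * B).+1%:R = 1 + k%:R * B%:R :> R by rewrite -natr1 natrM addrC.
split; apply: (@pow_le_linear _ _ _ K B%:R) => [||//|k];
  rewrite ?powR_ge0 ?mulr_ge0 ?(ltW D0) ?powR_ge0//.
  apply: le_trans (lowk k) _; rewrite exprMn -natE mulrCA ler_wpM2l ?exprn_ge0 ?(ltW D0)//.
  by rewrite -powX; exact: (lev _ _ (Tlev k)).1.
rewrite -powX; apply: le_trans (lev _ _ (Tlev k)).2 _.
by rewrite exprMn -natE ler_wpM2l ?mulr_ge0.
Qed.

(** After division by [mu] the moduli are at most 1 and are rounded up to powers of 1/2. Thus |a| <=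
    mu b <= 2|a| coordinatewise, and [eU] makes signs irrelevant up to [L]. *)
Lemma lp_bounds e (D L r : R) :
  1 <= D -> 1 <= L -> 0 < r ->
  (forall p q, (forall i, `|p`_i| <= `|q`_i|) -> `|lin e p| <= L * `|lin e q|) ->
  (forall B a, (forall i, a`_i = 0 \/ exists2 t, (t < B)%N & a`_i = 2^-1 ^+ t) ->
    `|lin e a| <= D * sum_powR r a `^ r^-1 /\ sum_powR r a `^ r^-1 <= D * `|lin e a|) ->
  forall a, `|lin e a| <= 2 * L * D * sum_powR r a `^ r^-1 /\
            sum_powR r a `^ r^-1 <= 2 * L * D * `|lin e a|.
Proof.
move=> D1 L1 r0 eU lev a.
have D0 : 0 < D by exact: lt_le_trans D1.
have L0 : 0 < L by exact: lt_le_trans L1.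
have [->|a0] := eqVneq a 0.
  rewrite linear0 normr0 /sum_powR size_poly0 big_ord0 powR0 ?mulr0//.
  by rewrite gt_eqF// invr_gt0.
pose mu := \sum_(i < size a) `|a`_i|.
have amu i : `|a`_i| <= mu.
  have [ia|ia] := ltnP i (size a); last by rewrite nth_default// normr0 sumr_ge0.
  by rewrite /mu (bigD1 (Ordinal ia)) //= lerDl sumr_ge0.
have mu0 : 0 < mu.
  by apply: lt_le_trans (amu (size a).-1); rewrite normr_gt0 -[_`__]/(lead_coef a) lead_coef_eq0.
have /choice[t tP] : forall i, exists t, a`_i != 0 ->
    `|a`_i| / mu <= 2^-1 ^+ t /\ 2^-1 ^+ t <= 2 * (`|a`_i| / mu).
  move=> i; have [->|ai] := eqVneq a`_i 0; first by exists 0%N.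
  have [||s ?] := dyadic_rounding (`|a`_i| / mu); last by exists s.
    by rewrite divr_gt0// normr_gt0.
  by rewrite ler_pdivrMr// mul1r.
pose b : {poly R} := \poly_(i < size a) (if a`_i == 0 then 0 else 2^-1 ^+ t i).
have bE i : b`_i = if a`_i == 0 then 0 else 2^-1 ^+ t i.
  by rewrite coef_poly; case: ltnP => // ai; rewrite nth_default// eqxx.
pose B := (\sum_(i < size a) t i).+1.
have bB i : b`_i = 0 \/ exists2 s, (s < B)%N & b`_i = 2^-1 ^+ s.
  rewrite bE; case: eqVneq => ai; first by left.
  right; exists (t i) => //; have ia : (i < size a)%N.
    by rewrite ltnNge; apply: contra_neqN ai => /(nth_default 0).
  by rewrite ltnS (bigD1 (Ordinal ia)) //= leq_addr.
have half0 s : 0 <= 2^-1 ^+ s :> R by rewrite exprn_ge0.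
have ab i : `|a`_i| <= `|(mu *: b)`_i|.
  rewrite coefZ bE; case: eqVneq => ai; first by rewrite ai mulr0.
  rewrite normrM (ger0_norm (half0 _)) gtr0_norm// mulrC -ler_pdivrMr//.
  exact: (tP i ai).1.
have ba i : `|(mu *: b)`_i| <= `|(2 *: a)`_i|.
  rewrite !coefZ bE; case: eqVneq => ai; first by rewrite ai !mulr0.
  rewrite !normrM (ger0_norm (half0 _)) gtr0_norm// ger0_norm// mulrC -ler_pdivlMr// -mulrA.
  exact: (tP i ai).2.
have powZ k c : sum_powR r (k *: c) `^ r^-1 = `|k| * sum_powR r c `^ r^-1.
  by rewrite sum_powRZ// powRM ?powR_ge0 ?sum_powR_ge0// -powRrM mulfV ?gt_eqF// powRr1.
have pow_le c (d : {poly R}) : (forall i, `|c`_i| <= `|d`_i|) ->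
    sum_powR r c `^ r^-1 <= sum_powR r d `^ r^-1.
  move=> cd; apply: ge0_ler_powR; rewrite ?nnegrE ?sum_powR_ge0 ?invr_ge0 ?(ltW r0)//.
  exact: sum_powR_le.
have [lev1 lev2] := lev B b bB; split.
  apply: le_trans (eU _ _ ab) _.
  rewrite (_ : 2 * L * D * _ = L * (2 * (D * sum_powR r a `^ r^-1))); last by ring.
  rewrite ler_wpM2l ?(ltW L0)//.
  rewrite linearZ normrZ mulrCA; apply: le_trans (ler_wpM2l (normr_ge0 mu) lev1) _.
  rewrite [leLHS]mulrCA ler_wpM2l ?(ltW D0)// -powZ; apply: le_trans (pow_le _ _ ba) _.
  by rewrite powZ ger0_norm.
apply: le_trans (pow_le _ _ ab) _; rewrite powZ.
apply: le_trans (ler_wpM2l (normr_ge0 mu) lev2) _.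
rewrite mulrCA [2 * L * D]mulrC -mulrA ler_wpM2l ?(ltW D0)//.
have -> : `|mu| * `|lin e b| = `|lin e (mu *: b)| by rewrite linearZ normrZ.
apply: le_trans (eU _ _ ba) _.
by rewrite linearZ normrZ ger0_norm// mulrA [L * 2]mulrC.
Qed.

End TensorPower.

(** * The sequence spaces *)

Section SequenceSpaces.
Context {R : realType}.

Lemma lincomb_unit_vector n (a : nat -> R) :
  lincomb unit_vector n a = fun k => (\poly_(i < n) a i)`_k.
Proof.
apply/funext => k; rewrite /lincomb fct_sumE coef_poly.
rewrite (eq_bigr (fun i : 'I_n => a i * (k == i)%:R))//.
case: ltnP => kn.
  rewrite (bigD1 (Ordinal kn)) //= eqxx mulr1 big1 ?addr0// => i ik.
  by rewrite eq_sym (_ : _ == _ = false) ?mulr0//; apply/negbTE.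
by rewrite big1// => i _; rewrite gtn_eqF ?mulr0//; exact: leq_trans kn.
Qed.

Lemma lp_norm_poly r (p : {poly R}) : 0 < r ->
  lp_norm r (fun k => p`_k : R^o) = sum_powR r p `^ r^-1.
Proof.
move=> r0; rewrite /lp_norm Lnorm_counting//.
have -> : (\sum_(k <oo) (`|(EFin \o (fun k => p`_k : R^o)) k| `^ r) = (sum_powR r p)%:E)%E.
  rewrite (@nneseries_split _ _ 0 (size p)); last by move=> k _; exact: poweR_ge0.
  rewrite [X in (_ + X)%E]eseries0 ?adde0; last first.
    move=> k pk _ /=; rewrite nth_default; last by rewrite add0n in pk.
    by rewrite normr0 powR0// gt_eqF.
  rewrite add0n big_mkord /sum_powR -sumEFin.
  by apply: eq_bigr => i _; rewrite -poweR_EFin.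
by rewrite poweR_EFin.
Qed.

End SequenceSpaces.

(** * The exponent of the power law and the two cases *)

Theorem proposition8 (R : realType) (X : completeNormedModType R)
    (e : nat -> X) (phi : bb e -> bb e) :
  rosenthal_basis e ->
  continuous (phi : bbE e -> bbD e) ->
  (forall x : bb e,
    (exists2 s : nat -> nat, increasing s & set_val (phi x) = set_val x \o s)
    /\ dominates Num.norm (set_val (phi x)) Num.norm e) ->
  equivalent Num.norm e c0_norm unit_vector
  \/ (exists2 p : R, 1 <= p & equivalent Num.norm e (lp_norm p) unit_vector).
Proof.
move=> eR cphi phiP; have [_ e1 _] := eR.
have [C C1 eC] := rosenthal_subsymmetric e eR.
have [U U1 eU] := rosenthal_unconditional e eR.
have [D1 D1_1 low1] := tensor_lower e phi eR cphi phiP.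
have [D2 D2_1 up2] := tensor_upper e eR.
pose D := Num.max D1 D2; pose L := 2 * U + 1.
have D_1 : 1 <= D by rewrite le_max D1_1.
have low n (b c : {poly R}) : (size c <= n)%N ->
    `|lin e b| * `|lin e c| <= D * `|lin e (tensor n b c)|.
  by move=> /(low1 n b c) /le_trans; apply; rewrite ler_wpM2r// le_max lexx.
have up n (b c : {poly R}) : (size c <= n)%N ->
    `|lin e (tensor n b c)| <= D * (`|lin e b| * `|lin e c|).
  move=> /(up2 n b c) /le_trans; apply.
  by rewrite ler_wpM2r ?mulr_ge0// le_max lexx orbT.
have L_1 : 1 <= L by rewrite /L lerDr mulr_ge0// (le_trans _ U1).
have L0 : 0 < L by exact: lt_le_trans L_1.
have eL (p q : {poly R}) : (forall i, `|p`_i| <= `|q`_i|) -> `|lin e p| <= L * `|lin e q|.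
  exact: unconditional_le.
pose l n := `|lin e (ones n)|.
have ones0 : ones 0 = 0 :> {poly R} by rewrite /ones poly_def big_ord0.
have l0 : l 0%N = 0 by rewrite /l ones0 linear0 normr0.
have [|||||a [a0 a1 [M M1 lM]]] := quasi_multiplicative_power l L D D_1.
- by rewrite /l /ones poly_def big_ord1 scale1r linX.
- move=> m n mn; apply: eL => i; rewrite !coef_poly.
  by case: ltnP => im; rewrite ?(leq_trans im mn)// normr0.
- move=> m [|n]; first by rewrite muln0 l0 !mulr0.
  by rewrite /l -(tensor_ones m)//; apply: low; exact: size_poly.
- move=> m [|n]; first by rewrite muln0 l0 !mulr0.
  by rewrite /l -(tensor_ones m)//; apply: up; exact: size_poly.
- move=> n; rewrite /l lin_poly; apply: le_trans (ler_norm_sum _ _ _) _.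
  rewrite -[n in leRHS]card_ord -sumr_const; apply: ler_sum => i _.
  by rewrite scale1r e1.
have M0 : 0 < M by exact: lt_le_trans M1.
(* For exponent 0 the norms of [ones n] are bounded, which gives c_0; otherwise the space is l_r
   with [r] the inverse of [a], and [a <= 1] gives [1 <= r]. *)
have [a_eq0|a_neq0] := eqVneq a 0; [left|right].
  have lM1 n : l n <= M.
    case: n => [|n]; first by rewrite l0 ltW.
    by have [+ _] := lM n.+1 isT; rewrite a_eq0 powRr0 mulr1.
  exists (L * M); first exact: mulr_ege1.
  move=> n c; rewrite lincomb_unit_vector -lin_poly; set p := \poly_(i < n) c i.
  have coef_le k : `|p`_k| <= L * `|lin e p|.
    rewrite -[leLHS]mulr1 -(e1 k) -(linX e) -normrZ -linearZ; apply: eL => i.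
    rewrite coefZ coefXn; case: eqP => [->|_]; first by rewrite mulr1.
    by rewrite mulr0 normr0.
  have range_ub : has_ubound (range (fun k => `|p`_k|)).
    by exists (L * `|lin e p|) => _ [k _ <-].
  have coef_sup k : `|p`_k| <= c0_norm (fun k => p`_k : R^o).
    by apply: ub_le_sup => //; exists k.
  have sup0 : 0 <= c0_norm (fun k => p`_k : R^o) by exact: le_trans (coef_sup 0%N).
  split.
    rewrite ler_pdivrMl ?mulr_gt0//.
    (* The coefficients of [p] are dominated by its supremum times [ones (size p)], whose norm is at
       most [M] times that supremum. *)
    apply: (@le_trans _ _ (L * `|lin e (c0_norm (fun k => p`_k : R^o) *: ones (size p))|)).
      apply: eL => i; rewrite coefZ [(ones _)`_i]coef_poly.
      have [ip|ip] := ltnP i (size p); last by rewrite nth_default// mulr0.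
      by rewrite mulr1 [leRHS]ger0_norm.
    rewrite -mulrA ler_wpM2l ?(ltW L0)// linearZ normrZ ger0_norm// mulrC.
    by rewrite ler_wpM2r//; exact: lM1.
  apply: (@le_trans _ _ (L * `|lin e p|)).
    by apply: ge_sup; [exists `|p`_0|; exists 0%N|move=> _ [k _ <-]].
  by rewrite ler_wpM2r// ler_peMr// ltW.
have a_gt0 : 0 < a by rewrite lt0r a_neq0.
pose r := a^-1; have r0 : 0 < r by rewrite invr_gt0.
have r1 : 1 <= r by rewrite invf_ge1.
have lMr n : (0 < n)%N -> `|lin e (ones n)| <= M * n%:R `^ r^-1 /\
    n%:R `^ r^-1 <= M * `|lin e (ones n)|.
  by rewrite /r invrK; exact: lM.
have lev := level_bounds e C L M r eC C1 L_1 M1 r1 eL lMr.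
have K0 : 0 <= C * M * L by rewrite !mulr_ge0// ltW// (lt_le_trans _ C1).
have powb := tensor_power_bounds e D (C * M * L) r e1 D_1 K0 r0 low up lev.
have bnd := lp_bounds e D L r D_1 L_1 r0 eL powb.
exists r => //; exists (2 * L * D).
  by rewrite mulr_ege1// mulr_ege1// ler1n.
move=> n c; rewrite lincomb_unit_vector lp_norm_poly// -lin_poly.
have [b1 b2] := bnd (\poly_(i < n) c i); split=> //.
by rewrite ler_pdivrMl// !mulr_gt0// (lt_le_trans _ D_1).
Qed.
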